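(* Let $(X_0,X_1)$ be a compatible couple and let $b\in SV(0,\infty)\cap AC(0,\infty)$ satisfy $$b\ \text{is strictly decreasing},\quad b(0)<\infty,\quad b(\infty)=0.$$ Let $\beta\in SV(0,\infty)\cap AC(0,\infty)$ be such that $$\beta\ \text{is strictly decreasing},\quad \beta(0)=\infty,\quad \beta(\infty)=0,$$ assume that $B\in SV(0,\infty)$ is given by $$B(x):=b(x)\ \text{ if } x\in[1,\infty),\qquad B(x):=c\,\beta(x)\ \text{ if } x\in(0,1),$$ where $c$ is a positive constant chosen in such a way that $B\in AC(0,\infty)$, and let $$A(x):=\frac{B^2(x)}{x(-B'(x))}\quad\text{for a.a. } x>0.$$ Then $$(X_0,X_1)_{0,\infty,b;K}=(X_0,X_1)_{0,\infty,b;K;(1,\infty)},$$ $$(X_0,X_0+X_1)_{0,\infty,B;K}=(X_0,X_0+X_1)_{0,\infty,B;K;(1,\infty)}.$$ Moreover, if $\|A(t)\|_{\infty,(1,e)}<\infty$, then also $$(X_0,X_0+X_1)_{0,\infty,A;J}=(X_0,X_0+X_1)_{0,\infty,A;J;(1,\infty)}.$$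
   Context: A pair $(Y_0,Y_1)$ of Banach spaces is a compatible couple if there is a Hausdorff topological vector space in which both are continuously embedded. $Y_0\cap Y_1$ carries the norm $\max\{\|f\|_{Y_0},\|f\|_{Y_1}\}$ and $Y_0+Y_1$ the norm $\inf\{\|f_0\|_{Y_0}+\|f_1\|_{Y_1}: f=f_0+f_1\}$. For $t>0$, $$K(f,t;Y_0,Y_1):=\inf\{\|f_0\|_{Y_0}+t\|f_1\|_{Y_1}: f=f_0+f_1,\ f_0\in Y_0,\ f_1\in Y_1\}\quad (f\in Y_0+Y_1),$$ $$J(f,t;Y_0,Y_1):=\max\{\|f\|_{Y_0},t\|f\|_{Y_1}\}\quad (f\in Y_0\cap Y_1).$$ $\|\cdot\|_{\infty,(c,d)}$ is the $L_\infty$-norm (essential supremum) on $(c,d)$. For an interval $I=(0,\infty)$ or $I=(1,\infty)$ and a measurable non-negative weight $v$ define: - the $K$-space on $I$: all $f\in Y_0+Y_1$ with $\|v(t)K(f,t;Y_0,Y_1)\|_{\infty,I}<\infty$, this expression being the norm; - the $J$-space on $I$: all $f\in Y_0+Y_1$ for which there is a strongly measurable $u:I\to Y_0\cap Y_1$ with $f=\int_I u(s)\,\frac{ds}{s}$ (convergence in $Y_0+Y_1$) and for which $\inf\|v(t)J(u(t),t;Y_0,Y_1)\|_{\infty,I}$ is finite, the infimum (which is the norm of $f$) being over all such representations of $f$. For $I=(0,\infty)$ these are denoted $(Y_0,Y_1)_{0,\infty,v;K}$ and $(Y_0,Y_1)_{0,\infty,v;J}$; for $I=(1,\infty)$ they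 are denoted $(Y_0,Y_1)_{0,\infty,v;K;(1,\infty)}$ and $(Y_0,Y_1)_{0,\infty,v;J;(1,\infty)}$. The convention $a/0=\infty$ for $a\in(0,\infty)$ is used (and $0\cdot\infty=0$ in the weighted norms). Equality of two spaces means that they are equal as sets and their norms are equivalent. $SV(0,\infty)$ is the set of slowly varying functions: positive, finite, Lebesgue-measurable functions $b$ on $(0,\infty)$ such that for each $\varepsilon>0$, $t^{\varepsilon}b(t)$ is equivalent to a non-decreasing function on $(0,\infty)$ and $t^{-\varepsilon}b(t)$ is equivalent to a non-increasing function on $(0,\infty)$ (two non-negative functions are equivalent if each is bounded by a positive constant multiple of the other). $AC(0,\infty)$ is the set of functions that are absolutely continuous on every compact subinterval of $(0,\infty)$. For monotone $f$ on $(0,\infty)$, $f(0):=\lim_{t\to0+}f(t)$ and $f(\infty):=\lim_{t\to\infty}f(t)$. *)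

(* Defs.v *)
From HB Require Import structures.
From mathcomp Require Import all_boot all_order all_algebra.
From mathcomp Require Import lra.
From mathcomp Require Import all_classical all_reals all_analysis.
Set Implicit Arguments.
Unset Strict Implicit.
Unset Printing Implicit Defensive.
Import Order.TTheory GRing.Theory Num.Theory.
Import numFieldNormedType.Exports.

Local Open Scope classical_set_scope.
Local Open Scope ring_scope.

(* Scalars are real: a complex couple is a real one by restriction of scalars,
   and the norms, K, J and the Bochner integral do not see the difference. *)
Record compatible_couple (R : realType) := CompatibleCouple {
  space0 : completeNormedModType R;
  space1 : completeNormedModType R;
  ambient : topologicalLmodType R;
  ambient_hausdorff : hausdorff_space ambient;
  emb0 : {linear space0 -> ambient};
  emb1 : {linear space1 -> ambient};
  emb0_inj : injective emb0;
  emb1_inj : injective emb1;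
  emb0_continuous : continuous emb0;
  emb1_continuous : continuous emb1
}.

Section sum_space.
Context {R : realType} (c : compatible_couple R).

Definition in_sum : {pred ambient c} :=
  fun z => `[< exists x0 x1, z = emb0 c x0 + emb1 c x1 >].

Fact in_sum_submod_closed : GRing.subsemimod_closed in_sum.
Proof.
split; first split.
- by apply/asboolP; exists 0, 0; rewrite !raddf0 addr0.
- move=> x y /asboolP[x0 [x1 ->]] /asboolP[y0 [y1 ->]]; apply/asboolP.
  by exists (x0 + y0), (x1 + y1); rewrite !raddfD/= addrACA.
- move=> a x /asboolP[x0 [x1 ->]]; apply/asboolP.
  by exists (a *: x0), (a *: x1); rewrite !linearZ/= scalerDr.
Qed.
HB.instance Definition _ :=
  GRing.isSubmodClosed.Build R (ambient c) in_sum in_sum_submod_closed.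

Record sum_space := SumSpace { sum_val : ambient c; sum_valP : in_sum sum_val }.
HB.instance Definition _ := [isSub for sum_val].
HB.instance Definition _ := [Choice of sum_space by <:].
HB.instance Definition _ := [SubChoice_isSubLmodule of sum_space by <:].

Definition decompositions (f : sum_space) : set (space0 c * space1 c) :=
  [set p | sum_val f = emb0 c p.1 + emb1 c p.2].

Definition sum_norm (f : sum_space) : R :=
  inf [set `|p.1| + `|p.2| | p in decompositions f].

Lemma sum_norms_has_inf f :
  has_inf [set `|p.1| + `|p.2| | p in decompositions f].
Proof.
split; last by exists 0 => _ [p _ <-]; rewrite addr_ge0.
have /asboolP[x0 [x1 zE]] := sum_valP f.
by exists (`|x0| + `|x1|); exists (x0, x1).
Qed.

Lemma sum_norm_le f x0 x1 :
  sum_val f = emb0 c x0 + emb1 c x1 -> sum_norm f <= `|x0| + `|x1|.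
Proof.
move=> fE; apply: ge_inf; first by have [] := sum_norms_has_inf f.
by exists (x0, x1).
Qed.

Lemma sum_norm_lt f e : sum_norm f < e ->
  exists x0 x1, sum_val f = emb0 c x0 + emb1 c x1 /\ `|x0| + `|x1| < e.
Proof.
move=> fe; have e0 : 0 < e - sum_norm f by rewrite subr_gt0.
have [_ [[x0 x1] fE <-]] := inf_adherent e0 (sum_norms_has_inf f).
by rewrite -/(sum_norm f) subrKC => xe; exists x0, x1.
Qed.

Lemma sum_norm_ge0 f : 0 <= sum_norm f.
Proof.
apply: lb_le_inf; first by have [] := sum_norms_has_inf f.
by move=> _ [p _ <-]; rewrite addr_ge0.
Qed.

Lemma ler_sum_normD f g : sum_norm (f + g) <= sum_norm f + sum_norm g.
Proof.
apply/ler_addgt0Pr => e e0.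
have [x0 [x1 [fE xe]]] : exists x0 x1, sum_val f = emb0 c x0 + emb1 c x1 /\
    `|x0| + `|x1| < sum_norm f + e / 2.
  by apply: sum_norm_lt; rewrite ltrDl divr_gt0.
have [y0 [y1 [gE ye]]] : exists x0 x1, sum_val g = emb0 c x0 + emb1 c x1 /\
    `|x0| + `|x1| < sum_norm g + e / 2.
  by apply: sum_norm_lt; rewrite ltrDl divr_gt0.
have fgE : sum_val (f + g) = emb0 c (x0 + y0) + emb1 c (x1 + y1).
  by rewrite !raddfD/= fE gE addrACA.
apply: (le_trans (sum_norm_le fgE)).
have := ler_normD x0 y0; have := ler_normD x1 y1; lra.
Qed.

Lemma sum_normZ a f : sum_norm (a *: f) = `|a| * sum_norm f.
Proof.
wlog suff leZ : a f / sum_norm (a *: f) <= `|a| * sum_norm f.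
  apply/eqP; rewrite eq_le leZ/=; have [->|a0] := eqVneq a 0.
    by rewrite normr0 mul0r sum_norm_ge0.
  rewrite -ler_pdivlMl ?normr_gt0// -normfV -[f in leLHS]scale1r.
  by rewrite -(mulVf a0) -scalerA leZ.
have [->|a0] := eqVneq a 0.
  rewrite normr0 mul0r scale0r (le_trans (@sum_norm_le 0 0 0 _))//.
    by rewrite !raddf0 addr0.
  by rewrite !normr0 addr0.
rewrite -ler_pdivrMl ?normr_gt0//; apply: lb_le_inf.
  by have [] := sum_norms_has_inf f.
move=> _ [[x0 x1] fE <-]; rewrite ler_pdivrMl ?normr_gt0// mulrDr -!normrZ/=.
by apply: sum_norm_le; rewrite !linearZ/= [sum_val f]fE scalerDr.
Qed.

Lemma sum_val_small (U : set (ambient c)) : nbhs 0 U ->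
  exists2 e : R, 0 < e & forall f, sum_norm f < e -> U (sum_val f).
Proof.
move=> U0.
have : (fun p : ambient c * ambient c => p.1 + p.2) @ nbhs (0, 0) --> 
    (0 + 0 : ambient c) := @add_continuous _ (0, 0).
rewrite addr0 => /(_ _ U0)[[U0' U1'] /= [U0'0 U1'0] U01].
have /(_ U0') := @emb0_continuous R c 0; rewrite raddf0 => /(_ U0'0).
move=> /nbhs_ballP[e0 /= e0_gt0 e0U].
have /(_ U1') := @emb1_continuous R c 0; rewrite raddf0 => /(_ U1'0).
move=> /nbhs_ballP[e1 /= e1_gt0 e1U].
exists (Num.min e0 e1); first by rewrite lt_min e0_gt0.
move=> f /sum_norm_lt[x0 [x1 [-> ]]]; rewrite lt_min => /andP[xe0 xe1].
have := normr_ge0 x0; have := normr_ge0 x1 => x1_ge0 x0_ge0.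
apply: (U01 (_, _)); split; [apply: e0U|apply: e1U].
  by rewrite -ball_normE/= sub0r normrN; lra.
by rewrite -ball_normE/= sub0r normrN; lra.
Qed.

Lemma sum_norm_eq0 f : sum_norm f = 0 -> f = 0.
Proof.
move=> f0; apply: val_inj; rewrite raddf0/=; apply/esym.
apply: (@ambient_hausdorff R c) => A B A0 Bf.
exists (sum_val f); split; last exact: nbhs_singleton.
by have [e e0] := sum_val_small A0; apply; rewrite f0.
Qed.

HB.instance Definition _ := Lmodule_isNormed.Build R sum_space
  ler_sum_normD sum_normZ sum_norm_eq0.

Lemma sum_val_is_linear : linear sum_val.
Proof. by move=> a f g; rewrite [LHS](linearP (val : sum_space -> ambient c)). Qed.
HB.instance Definition _ :=
  GRing.isLinear.Build R sum_space (ambient c) _ sum_val sum_val_is_linear.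

Lemma sum_valD f g : sum_val (f + g) = sum_val f + sum_val g.
Proof. exact: raddfD. Qed.

Lemma sum_valB f g : sum_val (f - g) = sum_val f - sum_val g.
Proof. exact: raddfB. Qed.

Lemma sum_val_continuous : continuous sum_val.
Proof.
move=> f U.
have : (fun z : ambient c => sum_val f + z) @ nbhs 0 --> sum_val f.
  rewrite -[X in _ --> X]addr0.
  apply: (@continuous_comp _ _ _ (fun z : ambient c => (sum_val f, z))
    (fun p => p.1 + p.2)); last exact: add_continuous.
  by apply: cvg_pair => /=; [exact: cvg_cst|exact: cvg_id].
move=> /[apply] /sum_val_small[e e0 eU].
apply/nbhs_ballP; exists e => //= g.
rewrite -ball_normE/= distrC => /eU.
by rewrite sum_valB /= subrKC.
Qed.

(* A Cauchy filter is followed along dyadic balls; the lifts of successive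
   differences sum up in both spaces. *)
Lemma sum_complete (F : set_system sum_space) :
  ProperFilter F -> cauchy F -> cvg F.
Proof.
move=> FF /cauchyP Fc.
pose r n : R := 2^-1 ^+ n.
have r_gt0 n : 0 < r n by rewrite exprn_gt0.
have rS n : r n = 2 * r n.+1 by rewrite /r exprS mulrA divff ?mul1r.
have /choice[g Fg] : forall n, exists x, F (ball x (r n)).
  by move=> n; exact: Fc.
have gS n : `|g n.+1 - g n| < 2 * r n.
  have [z [gz gSz]] := filter_ex (filterI (Fg n) (Fg n.+1)).
  move: gz gSz; rewrite -!ball_normE/= => gz gSz.
  have -> : g n.+1 - g n = (g n.+1 - z) - (g n - z) by rewrite opprB addrA subrK.
  rewrite (le_lt_trans (ler_normB _ _))//.
  have := r_gt0 n.+1; move: (rS n) gz gSz; lra.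
have /choice[x xP] : forall n, exists x : space0 c * space1 c,
    sum_val (g n.+1 - g n) = emb0 c x.1 + emb1 c x.2 /\
    `|x.1| + `|x.2| < 2 * r n.
  by move=> n; have [x0 [x1 ?]] := sum_norm_lt (gS n); exists (x0, x1).
have cvg_r : cvgn (series (fun n => 2 * r n)).
  apply: is_cvg_geometric_series; rewrite ger0_norm ?invr_ge0//.
  by rewrite invf_lt1// ltr1n.
have cvg0 : cvgn (series (fun n => (x n).1)).
  apply: normed_cvg; apply: series_le_cvg cvg_r => //= n.
    by rewrite mulr_ge0// ltW.
  have [_ /ltW] := xP n; apply: le_trans; by rewrite lerDl.
have cvg1 : cvgn (series (fun n => (x n).2)).
  apply: normed_cvg; apply: series_le_cvg cvg_r => //= n.
    by rewrite mulr_ge0// ltW.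
  have [_ /ltW] := xP n; apply: le_trans; by rewrite lerDr.
set l0 := limn (series (fun n => (x n).1)) in cvg0.
set l1 := limn (series (fun n => (x n).2)) in cvg1.
have lP : in_sum (emb0 c l0 + emb1 c l1) by apply/asboolP; exists l0, l1.
pose l := g 0%N + SumSpace lP.
have gE n : sum_val (l - g n) =
    emb0 c (l0 - series (fun n => (x n).1) n) +
    emb1 c (l1 - series (fun n => (x n).2) n).
  have gnE : sum_val (g n - g 0%N) = emb0 c (series (fun n => (x n).1) n) +
      emb1 c (series (fun n => (x n).2) n).
    elim: n => [|n IHn]; first by rewrite /series/= !big_geq// subrr !raddf0 addr0.
    have -> : g n.+1 - g 0%N = (g n - g 0%N) + (g n.+1 - g n).
      by rewrite [RHS]addrC addrA subrK.
    rewrite sum_valD IHn (xP n).1.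
    by rewrite !seriesSr !raddfD addrACA.
  have -> : l - g n = SumSpace lP - (g n - g 0%N).
    by rewrite /l opprB addrCA addrA.
  by rewrite sum_valB gnE !raddfB opprD addrACA.
apply/cvg_ex; exists l; apply/cvgrPdist_lt => e e0.
have [n [ln rn]] : exists n, `|l - g n| < e / 2 /\ r n < e / 2.
  have e4 : 0 < e / 4 by rewrite divr_gt0.
  have e2 : 0 < e / 2 by rewrite divr_gt0.
  have /cvgrPdist_lt /(_ _ e4) near0 := cvg0.
  have /cvgrPdist_lt /(_ _ e4) near1 := cvg1.
  have : r @ \oo --> 0.
    by apply: cvg_expr; rewrite ger0_norm ?invr_ge0// invf_lt1// ltr1n.
  move=> /cvgrPdist_lt /(_ _ e2) nearr.
  have [n [[n0 n1] nr]] := filter_ex (filterI (filterI near0 near1) nearr).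
  exists n; split; last by move: nr; rewrite /= sub0r normrN gtr0_norm.
  by rewrite (le_lt_trans (sum_norm_le (gE n)))//; lra.
apply: filterS (Fg n) => z; rewrite -ball_normE/= => gz.
rewrite -(subrKA (g n)) (le_lt_trans (ler_normD _ _))//; lra.
Qed.

HB.instance Definition _ := Uniform_isComplete.Build sum_space sum_complete.
End sum_space.

Definition sum_couple (R : realType) (c : compatible_couple R) :
    compatible_couple R :=
  @CompatibleCouple R (space0 c) (sum_space c) (ambient c) (@ambient_hausdorff R c)
    (emb0 c) (@sum_val R c) (@emb0_inj R c) val_inj (@emb0_continuous R c)
    (@sum_val_continuous R c).

Section cap_space.
Context {R : realType} (c : compatible_couple R).

(* An element of the intersection is a pair of elements of the two spaces with
   the same image in the ambient space. *)
Definition in_cap : {pred (space0 c * space1 c)%type} :=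
  fun p => `[< emb0 c p.1 = emb1 c p.2 >].

Fact in_cap_submod_closed : GRing.subsemimod_closed in_cap.
Proof.
split; first split.
- by apply/asboolP; rewrite !raddf0.
- by move=> x y /asboolP xE /asboolP yE; apply/asboolP; rewrite !raddfD/= xE yE.
- by move=> a x /asboolP xE; apply/asboolP; rewrite !linearZ/= xE.
Qed.
HB.instance Definition _ := GRing.isSubmodClosed.Build R
  (space0 c * space1 c)%type in_cap in_cap_submod_closed.

Record cap_space :=
  CapSpace { cap_val : space0 c * space1 c; cap_valP : in_cap cap_val }.
HB.instance Definition _ := [isSub for cap_val].
HB.instance Definition _ := [Choice of cap_space by <:].
HB.instance Definition _ := [SubChoice_isSubLmodule of cap_space by <:].

Definition cap_norm (f : cap_space) : R :=
  Num.max `|(cap_val f).1| `|(cap_val f).2|.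

Lemma ler_cap_normD f g : cap_norm (f + g) <= cap_norm f + cap_norm g.
Proof.
rewrite /cap_norm ge_max !(le_trans (ler_normD _ _))//;
  by rewrite lerD// le_max lexx ?orbT.
Qed.

Lemma cap_normZ a f : cap_norm (a *: f) = `|a| * cap_norm f.
Proof. by rewrite /cap_norm !normrZ maxr_pMr. Qed.

Lemma cap_norm_eq0 f : cap_norm f = 0 -> f = 0.
Proof.
rewrite /cap_norm => f0; apply: val_inj => /=.
have : `|(cap_val f).1| <= 0 by rewrite -f0 le_max lexx.
have : `|(cap_val f).2| <= 0 by rewrite -f0 le_max lexx orbT.
by rewrite !normr_le0; case: (cap_val f) => x y /= /eqP -> /eqP ->.
Qed.

HB.instance Definition _ := Lmodule_isNormed.Build R cap_space
  ler_cap_normD cap_normZ cap_norm_eq0.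

Fact in_sum_emb0 (x : space0 c) : in_sum (emb0 c x).
Proof. by apply/asboolP; exists x, 0; rewrite raddf0 addr0. Qed.

Definition cap_in_sum (f : cap_space) : sum_space c :=
  SumSpace (in_sum_emb0 (cap_val f).1).

Definition K_functional (f : sum_space c) (t : R) : R :=
  inf [set `|p.1| + t * `|p.2| | p in decompositions f].

Definition J_functional (f : cap_space) (t : R) : R :=
  Num.max `|(cap_val f).1| (t * `|(cap_val f).2|).
End cap_space.

Section bochner.
Context d (T : measurableType d) (R : realType) (V : normedModType R).
Variable mu : {measure set T -> \bar R}.
Implicit Types (s u : T -> V) (x : V).

Definition simple_fun s :=
  finite_set (range s) /\ forall x, measurable (s @^-1` [set x]).

Definition strongly_measurable u :=
  exists s_ : nat -> T -> V, (forall n, simple_fun (s_ n)) /\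
    {ae mu, forall t, s_ n t @[n --> \oo] --> u t}.

Definition integrable_simple_fun s :=
  simple_fun s /\ forall x, x != 0 -> (mu (s @^-1` [set x]) < +oo)%E.

Definition simple_fun_integral s : V :=
  \sum_(x \in [set~ 0]) fine (mu (s @^-1` [set x])) *: x.

(* When u is strongly measurable, `|u t - s_ n t| is only measurable for the
   completed sigma-algebra; its Borel lower integral is then its integral. *)
Definition is_bochner_integral u x :=
  strongly_measurable u /\
  exists s_ : nat -> T -> V, [/\ forall n, integrable_simple_fun (s_ n),
    (\int[mu]_t `|u t - s_ n t|%:E)%E @[n --> \oo] --> 0%E &
    simple_fun_integral (s_ n) @[n --> \oo] --> x].
End bochner.

(* This measure has no mass off i, so that only the values on i of a function
   defined on R matter for its norm, measurability and integral. *)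
Definition lebesgue_on (R : realType) (i : interval R) :
    set (measurableTypeR R) -> \bar R :=
  mrestr lebesgue_measure (measurable_itv i).
HB.instance Definition _ (R : realType) (i : interval R) :=
  Measure.on (lebesgue_on i).

Definition Linf_norm (R : realType) (i : interval R) (f : R -> \bar R) : \bar R :=
  ('N[lebesgue_on i]_+oo[f])%E.
Arguments Linf_norm {R} i f.

Section interpolation_spaces.
Context {R : realType} (c : compatible_couple R).
Variables (v : R -> \bar R) (i : interval R).
Local Open Scope ereal_scope.

Definition K_norm (f : sum_space c) : \bar R :=
  Linf_norm i (fun t => v t * (K_functional f t)%:E).

(* Convergence of the integral in the sum means Bochner integrability there. *)
Definition J_representation (f : sum_space c) (u : R -> cap_space c) :=
  strongly_measurable (lebesgue_on i) u /\
  is_bochner_integral (lebesgue_on i)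
    (fun s => (s^-1)%R *: cap_in_sum (u s)) f.

(* The infimum of the empty set is +oo: the norm is infinite when f has no
   representation. *)
Definition J_norm (f : sum_space c) : \bar R :=
  ereal_inf [set Linf_norm i (fun t => v t * (J_functional (u t) t)%:E)
            | u in J_representation f].
End interpolation_spaces.
Arguments K_norm {R} c v i f.
Arguments J_norm {R} c v i f.

(* A space is given by an extended norm, and consists of the elements at which
   this norm is finite. *)
Definition finite_part (R : realType) (E : Type) (N : E -> \bar R) : set E :=
  [set f | (N f < +oo)%E].

Definition equal_spaces (R : realType) (E : Type) (N N' : E -> \bar R) :=
  finite_part N = finite_part N' /\
  exists2 C : R, 0 < C & forall f, finite_part N f ->
    (N f <= C%:E * N' f)%E /\ (N' f <= C%:E * N f)%E.

Section functions_on_the_half_line.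
Context {R : realType}.
Implicit Types f g b : R -> R.

(* Measurability on ]0, +oo[ for the Lebesgue sigma-algebra. *)
Definition lebesgue_measurable f :=
  forall Y : set R, measurable Y ->
    caratheodory_measurable ((wlength idfun)^*%mu : set R -> \bar R)
      (`]0, +oo[ `&` f @^-1` Y).

Definition equivalent f g :=
  (exists2 C : R, 0 < C & forall x : R, 0 < x -> f x <= C * g x) /\
  (exists2 C : R, 0 < C & forall x : R, 0 < x -> g x <= C * f x).

Definition slowly_varying b :=
  [/\ forall x : R, 0 < x -> 0 < b x,
      lebesgue_measurable b &
      forall e : R, 0 < e ->
        (exists g, [/\ forall x : R, 0 < x -> 0 <= g x,
           {in `]0, +oo[ &, {homo g : x y / x <= y}} &
           equivalent (fun t => t `^ e * b t) g]) /\
        (exists g, [/\ forall x : R, 0 < x -> 0 <= g x,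
           {in `]0, +oo[ &, {homo g : x y /~ x <= y}} &
           equivalent (fun t => t `^ (- e) * b t) g])].

(* The degenerate intervals l k = r k are allowed and contribute nothing. *)
Definition absolutely_continuous_on (x y : R) f :=
  forall e : R, 0 < e -> exists2 d : R, 0 < d &
    forall (n : nat) (l r : 'I_n -> R),
      (forall k, x <= l k /\ l k <= r k /\ r k <= y) ->
      trivIset setT (fun k => `]l k, r k[%classic) ->
      \sum_(k < n) (r k - l k) < d ->
      \sum_(k < n) `|f (r k) - f (l k)| < e.

Definition locally_absolutely_continuous f :=
  forall x y : R, 0 < x -> x < y -> absolutely_continuous_on x y f.

Definition strictly_decreasing f :=
  {in `]0, +oo[ &, {homo f : x y /~ x < y}}.

Definition value_at_0 f : \bar R := lim ((f x)%:E @[x --> 0^'+]).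

Definition value_at_oo f : \bar R := lim ((f x)%:E @[x --> +oo]).

Definition glued b (beta : R -> R) (c : R) (x : R) : R :=
  if 1 <= x then b x else c * beta x.

(* In the extended reals, a / 0 = +oo for a > 0 and 0 * +oo = 0. *)
Definition weight_A (B : R -> R) (x : R) : \bar R :=
  ((B x ^+ 2)%:E / (x * - derive1 B x)%:E)%E.
End functions_on_the_half_line.

(* Main.v *)
From HB Require Import structures.
Require Import Defs.
From mathcomp Require Import all_boot all_order all_algebra.
From mathcomp Require Import all_classical all_reals all_analysis.
From mathcomp Require Import measurable_realfun ess_sup_inf ring lra.
Set Implicit Arguments.
Unset Strict Implicit.
Unset Printing Implicit Defensive.
Import Order.TTheory GRing.Theory Num.Theory.
Import numFieldNormedType.Exports.

Local Open Scope classical_set_scope.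
Local Open Scope ring_scope.

(** In each of the three equalities one of the two norms is at most the other for
    trivial reasons, and the part of the half-line below 1 has to be controlled
    by the part above 1.

    For the K-spaces, K(f, t) is nondecreasing in t, so that a bound of the
    weighted K-functional on ]1, 2[ bounds K(f, 1). On ]0, 1] the weight b is
    bounded; the weight B is not, but there K(f, t) is at most t K(f, 1) for the
    couple of X0 and X0 + X1, and t B(t) is bounded by slow variation. This is
    K_equal_spaces with K_functional_sum_couple.

    For the J-spaces, a representation over ]1, +oo[ is extended by zero
    (J_norm_extension). Conversely, let u represent f over ]0, +oo[ with
    A(t) J(u(t), t) <= M. For the couple of X0 and X0 + X1 the intersection is
    X0, hence on ]0, 1[ the X0-norm of u(t) / t is at most
    M / (t A(t)) = M (1 / B)'(t). As 1 / B is nondecreasing and positive, the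
    integral of its derivative over ]0, 1[ is at most 1 / B(2), by Fatou's lemma
    applied to difference quotients (integral_lower_derivative_le); replacing
    the derivative by the lower limit of these quotients covers the points
    without derivative, where A = +oo and u vanishes (weight_A_bound). The
    integral x of u(t) / t over ]0, 1[ thus exists in X0 with norm at most
    M / B(2) (J_representation_bound), and t x on ]1, 2[ has the same integral
    against dt / t. Moving the mass of u on ]0, 1[ to this interval
    (J_representation_replace) gives a representation over ]1, +oo[, whose norm
    is controlled because A is essentially bounded on ]1, e[, which contains
    ]1, 2[ (J_norm_restriction).

    The Bochner integral is developed from simple functions: linearity, images
    under bounded linear maps, existence for strongly measurable functions with
    integrable norm, and restriction to a subset. *)

(** * Simple functions and their integrals *)

Section simple_functions.
Context d (T : measurableType d) (R : realType).
Variable mu : {measure set T -> \bar R}.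
Implicit Types V W : normedModType R.

Import HBSimple.

(** Finiteness of the range makes every post-composition simple, measurable or
    not; this and the next lemma replace closure under each operation. *)
Lemma simple_fun_comp V W (q : T -> W) (phi : W -> V) :
  simple_fun q -> simple_fun (phi \o q).
Proof.
move=> [qfin qm]; split.
  by rewrite -[range _](image_comp q phi); exact: finite_image.
move=> x.
have -> : (phi \o q) @^-1` [set x] =
    \bigcup_(w in range q `&` phi @^-1` [set x]) q @^-1` [set w].
  apply/seteqP; split=> [t /= qx|t [w [_ /= <-] /= ->]]//.
  by exists (q t).
by apply: fin_bigcup_measurable => //; exact: finite_setIl.
Qed.

Lemma simple_fun_pair V W (s : T -> V) (q : T -> W) :
  simple_fun s -> simple_fun q -> simple_fun (fun t => (s t, q t) : (V * W)%type).
Proof.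
move=> [sfin sm] [qfin qm]; split.
  apply: (sub_finite_set _ (finite_setX sfin qfin)) => _ [t _ <-].
  by split; exists t.
move=> [x y].
have -> : (fun t => (s t, q t)) @^-1` [set (x, y)] =
    s @^-1` [set x] `&` q @^-1` [set y].
  by apply/seteqP; split=> t /= [-> ->].
exact: measurableI.
Qed.

Lemma simple_fun_indic (A : set T) : measurable A ->
  simple_fun (\1_A : T -> (R : normedModType R)).
Proof.
move=> mA; split; first exact: fimfunP.
by move=> x; rewrite -[X in measurable X]setTI; exact: measurable_indic.
Qed.

Lemma simple_fun_cst V (x : V) : simple_fun (fun _ : T => x).
Proof.
split; first by apply: (@sub_finite_set _ _ [set x]) => // _ [t _ <-].
move=> y; have [->|xy] := eqVneq y x.
  by rewrite (_ : _ @^-1` _ = setT)//; apply/seteqP; split.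
rewrite (_ : _ @^-1` _ = set0)//; apply/seteqP; split=> // t /= yx.
by move/eqP: xy; rewrite yx.
Qed.

(** Finite-valued functions are handled through a duplicate-free sequence that
    contains all their values, so that their integrals become ordinary big
    sums. *)
Lemma simple_fun_values V (s : T -> V) : simple_fun s ->
  exists2 r : seq V, uniq r & forall t, s t \in r.
Proof.
move=> [/finite_seqP[r rE] _]; exists (undup r); first exact: undup_uniq.
move=> t; rewrite mem_undup.
by have : range s (s t) by [exists t]; rewrite rE.
Qed.

Lemma simple_fun_measurable V (s : T -> V) (phi : V -> R) :
  simple_fun s -> measurable_fun setT (phi \o s).
Proof.
move=> ss _ Y mY; rewrite setTI.
have [_ m] := simple_fun_comp (fun v => \1_Y (phi v) : R) ss.
suff -> : (phi \o s) @^-1` Y = (fun t => \1_Y (phi (s t)) : R) @^-1` [set 1].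
  exact: m.
apply/seteqP; split=> t /=; first by move=> Yt; rewrite indicE mem_set.
rewrite indicE; have [/set_mem//|_ /eqP] := boolP (phi (s t) \in Y).
by rewrite eq_sym oner_eq0.
Qed.

Lemma simple_fun_integral_seq V (s : T -> V) (r : seq V) :
  uniq r -> (forall t, s t \in r) ->
  simple_fun_integral mu s =
    \sum_(x <- r | x != 0) fine (mu (s @^-1` [set x])) *: x.
Proof.
move=> ur sr; rewrite /simple_fun_integral -[RHS]big_filter.
rewrite [RHS](@fsbig_seq _ _ _ _ [seq x <- r | x != 0]) ?filter_uniq//.
apply/esym/fsbig_widen => [x|x [/= x0 xr]] /=.
  by rewrite mem_filter => /andP[/eqP].
rewrite [X in mu X](_ : _ = set0) ?measure0 ?scale0r//.
rewrite -subset0 => t /= sx; apply: xr.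
by rewrite mem_filter -sx sr andbT sx; exact/eqP.
Qed.

Lemma simple_fun_measure V (q : T -> V) (r : seq V) (P : pred V) :
    simple_fun q -> uniq r -> (forall t, q t \in r) ->
  mu [set t | P (q t)] = (\sum_(w <- r | P w) mu (q @^-1` [set w]))%E.
Proof.
move=> [_ qm] ur qr; rewrite -big_filter (@fsbig_seq _ _ _ _ [seq w <- r | P w]).
  rewrite -measure_fin_bigcup//; last first.
    by apply/trivIsetP => x y _ _ xy; rewrite -subset0 => t /= [-> /eqP]; apply/negP.
  congr (mu _); apply/seteqP; split=> [t /= Pt|t [w /=]].
    by exists (q t) => //=; rewrite mem_filter Pt qr.
  by rewrite mem_filter => /andP[Pw _] ->.
exact: filter_uniq.
Qed.

Lemma integrable_simple_fun_fin V (s : T -> V) x : integrable_simple_fun mu s ->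
  x != 0 -> mu (s @^-1` [set x]) \is a fin_num.
Proof. by move=> [_ sfin] x0; rewrite ge0_fin_numE ?measure_ge0// sfin. Qed.

Lemma integrable_simple_fun_comp V W (q : T -> W) (phi : W -> V) :
  phi 0 = 0 -> integrable_simple_fun mu q -> integrable_simple_fun mu (phi \o q).
Proof.
move=> phi0 iq; have [sq _] := iq; split; first exact: simple_fun_comp.
move=> x x0; have [r ur rq] := simple_fun_values sq.
rewrite (_ : _ @^-1` _ = [set t | phi (q t) == x]); last first.
  by apply/seteqP; split=> t /= /eqP.
rewrite (simple_fun_measure (fun w => phi w == x) sq ur rq).
apply: lte_sum_pinfty => w /eqP wx; rewrite ltey_eq integrable_simple_fun_fin//.
by apply: contra_neq x0 => w0; rewrite -wx w0.
Qed.

Lemma integrable_simple_fun_pair V W (s : T -> V) (q : T -> W) :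
    integrable_simple_fun mu s -> integrable_simple_fun mu q ->
  integrable_simple_fun mu (fun t => (s t, q t) : (V * W)%type).
Proof.
move=> is_ iq; have [[[_ sm] sfin] [[_ qm] qfin]] := (is_, iq).
split; first by apply: simple_fun_pair; [case: is_|case: iq].
move=> [x y] xy0; have [x0|x0] := eqVneq x 0.
  have y0 : y != 0 by apply: contra_neq xy0 => ->; rewrite x0.
  have [_ m] := simple_fun_pair is_.1 iq.1.
  apply: le_lt_trans (qfin y y0).
  by apply: le_measure; rewrite ?inE//= => t /= [_ ->].
have [_ m] := simple_fun_pair is_.1 iq.1.
apply: le_lt_trans (sfin x x0).
by apply: le_measure; rewrite ?inE//= => t /= [->].
Qed.

(** Grouping of values: the integral of a function of q can be computed on the
    level sets of q, although several of them may share one value of phi.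
    Linearity is the case where q is a pair of functions and phi the linear
    operation. *)
Lemma simple_fun_integral_comp V W (q : T -> W) (phi : W -> V) (r : seq W) :
    phi 0 = 0 -> integrable_simple_fun mu q ->
    uniq r -> (forall t, q t \in r) ->
  simple_fun_integral mu (phi \o q) =
    \sum_(w <- r | w != 0) fine (mu (q @^-1` [set w])) *: phi w.
Proof.
move=> phi0 iq ur rq; have [sq _] := iq.
have phi_r t : (phi \o q) t \in undup (map phi r).
  by rewrite mem_undup; exact: map_f (rq t).
rewrite (simple_fun_integral_seq (undup_uniq _) phi_r).
transitivity (\sum_(x <- undup (map phi r) | x != 0)
    \sum_(w <- r | phi w == x) fine (mu (q @^-1` [set w])) *: phi w).
  apply: eq_bigr => x x0.
  rewrite (_ : _ @^-1` _ = [set t | phi (q t) == x]); last first.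
    by apply/seteqP; split=> t /= /eqP.
  rewrite (simple_fun_measure (fun w => phi w == x) sq ur rq) -sum_fine.
    by rewrite scaler_suml; apply: eq_bigr => w /eqP ->.
  move=> w /eqP wx; apply: integrable_simple_fun_fin => //.
  by apply: contra_neq x0 => w0; rewrite -wx w0.
rewrite (exchange_big_dep predT)//= [RHS]big_mkcond/=.
rewrite !big_seq; apply: eq_bigr => w wr.
have [->|w0] := eqVneq w 0.
  by rewrite phi0 scaler0 big1.
have [pw0|pw0] := eqVneq (phi w) 0.
  by rewrite pw0 scaler0 big1.
rewrite (big_rem (phi w)) ?mem_undup ?map_f//= pw0 eqxx big_seq_cond big1 ?addr0//.
move=> x /andP[]; rewrite mem_rem_uniq ?undup_uniq// inE => /andP[xw _].
by move: xw; rewrite /= eq_sym => /negbTE ->; rewrite andbF.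
Qed.

Lemma simple_fun_integral_linear V W (L : {linear V -> W}) (s : T -> V) :
  integrable_simple_fun mu s ->
  simple_fun_integral mu (L \o s) = L (simple_fun_integral mu s).
Proof.
move=> is_; have [r ur rs] := simple_fun_values is_.1.
rewrite (simple_fun_integral_comp (raddf0 L) is_ ur rs).
rewrite (simple_fun_integral_seq ur rs) raddf_sum/=.
by apply: eq_bigr => x _; rewrite linearZ.
Qed.

Lemma integrable_simple_fun_lin V (a : R) (s q : T -> V) :
    integrable_simple_fun mu s -> integrable_simple_fun mu q ->
  integrable_simple_fun mu (fun t => s t + a *: q t).
Proof.
move=> is_ iq; have isq := integrable_simple_fun_pair is_ iq.
apply: (@integrable_simple_fun_comp _ _ _ (fun w => w.1 + a *: w.2) _ isq).
by rewrite /= scaler0 addr0.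
Qed.

Lemma simple_fun_integral_lin V (a : R) (s q : T -> V) :
    integrable_simple_fun mu s -> integrable_simple_fun mu q ->
  simple_fun_integral mu (fun t => s t + a *: q t) =
    simple_fun_integral mu s + a *: simple_fun_integral mu q.
Proof.
move=> is_ iq; have isq := integrable_simple_fun_pair is_ iq.
have [r ur rsq] := simple_fun_values isq.1.
have I phi phi0 := @simple_fun_integral_comp V _ _ phi r phi0 isq ur rsq.
rewrite (I (fun w => w.1 + a *: w.2)) ?scaler0 ?addr0// (I fst)// (I snd)//.
rewrite scaler_sumr -big_split/=; apply: eq_bigr => w _.
by rewrite scalerDr !scalerA [a * _]mulrC.
Qed.

Lemma simple_fun_integral_norm V (s : T -> V) : integrable_simple_fun mu s ->
  (`|simple_fun_integral mu s|%:E <= \int[mu]_t `|s t|%:E)%E.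
Proof.
move=> is_; have [r ur rs] := simple_fun_values is_.1.
rewrite (simple_fun_integral_seq ur rs).
have -> : (\int[mu]_t `|s t|%:E)%E =
    (\sum_(x <- r) \int[mu]_t (`|x|%:E * (\1_(s @^-1` [set x]) t)%:E))%E.
  rewrite -ge0_integral_sum//.
  - apply: eq_integral => t _.
    rewrite (big_rem (s t))//= indicE mem_set// mule1 big_seq big1 ?adde0//.
    move=> x; rewrite mem_rem_uniq// inE => /andP[xs _].
    by rewrite indicE memNset ?mule0//= => /esym/eqP; apply/negP.
  - move=> x; apply/measurable_EFinP; apply: measurable_funM => //.
    by apply: measurable_indic; have [[_]] := is_.
have I x : (\int[mu]_t (`|x|%:E * (\1_(s @^-1` [set x]) t)%:E) =
    `|x|%:E * mu (s @^-1` [set x]))%E.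
  have mx : measurable (s @^-1` [set x]) by have [[_]] := is_.
  rewrite (@ge0_integralZl_EFin _ _ _ mu _ measurableT
    (fun t => (\1_(s @^-1` [set x]) t)%:E))//.
  - by rewrite integral_indic ?setIT.
  - exact/measurable_EFinP/measurable_indic.
rewrite (eq_bigr _ (fun x _ => I x)).
apply: (@le_trans _ _ (\sum_(x <- r | x != 0)
    fine (mu (s @^-1` [set x])) * `|x|)%:E).
  rewrite lee_fin; apply: (le_trans (ler_norm_sum _ _ _)).
  by apply: ler_sum => x _; rewrite normrZ ger0_norm// fine_ge0.
rewrite -sumEFin big_mkcond/=; apply: lee_sum => x _.
case: eqVneq => [->|x0]; first by rewrite normr0 mul0e.
by rewrite EFinM fineK ?integrable_simple_fun_fin// muleC.
Qed.

End simple_functions.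

(** * Integrals of functions that are almost everywhere measurable *)

Section lower_integral.
Context d (T : measurableType d) (R : realType).
Variable mu : {measure set T -> \bar R}.
Local Open Scope ereal_scope.

Import HBNNSimple.

(** The integral of a non-negative function is a supremum over the simple
    functions below it, so that only the larger function has to be
    measurable. *)
Lemma ge0_ae_le_lower_integral (f g : T -> \bar R) :
    (forall t, 0 <= f t) -> (forall t, 0 <= g t) -> measurable_fun setT g ->
    {ae mu, forall t, f t <= g t} ->
  \int[mu]_t f t <= \int[mu]_t g t.
Proof.
move=> f0 g0 mg fg; rewrite [leLHS]ge0_integralTE//.
apply: ge_ereal_sup => _ [h /= hf <-].
rewrite -integralT_nnsfun; apply: ae_ge0_le_integral => //.
- by move=> t _; rewrite lee_fin fun_ge0.
- exact/measurable_EFinP/measurable_funP.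
- by apply: filterS fg => t fg _; exact: le_trans (hf t) fg.
Qed.

(** Measurability for the completed measure; the distance from a strongly
    measurable function to a simple one is measurable in this sense only. *)
Definition ae_measurable (f : T -> R) :=
  exists2 g : T -> R, measurable_fun setT g & {ae mu, forall t, f t = g t}.

Lemma ge0_ae_measurable_integral (f : T -> R) :
    (forall t, 0 <= f t)%R -> ae_measurable f ->
  exists g : T -> R, [/\ measurable_fun setT g, (forall t, 0 <= g t)%R,
    {ae mu, forall t, f t = g t} &
    \int[mu]_t (f t)%:E = \int[mu]_t (g t)%:E].
Proof.
move=> f0 [g mg fg]; exists (fun t => `|g t|%R).
have mg' : measurable_fun setT (fun t => `|g t|%R) by exact: measurableT_comp.
have fg' : {ae mu, forall t, f t = `|g t|%R}.
  by apply: filterS fg => t <-; rewrite ger0_norm.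
split => //; apply/eqP; rewrite eq_le; apply/andP; split.
  apply: ge0_ae_le_lower_integral => //.
  - exact/measurable_EFinP.
  - by apply: filterS fg' => t ->.
have [N [mN N0 fgN]] := fg'.
pose h t := ((\1_(~` N) t : R) * `|g t|)%R.
have mh : measurable_fun setT h.
  by apply: measurable_funM => //; apply: measurable_indic; exact: measurableC.
apply: (@le_trans _ _ (\int[mu]_t (h t)%:E)).
  apply: ge0_ae_le_lower_integral => //.
  - by move=> t; rewrite lee_fin mulr_ge0.
  - exact/measurable_EFinP.
  - exists N; split=> // t /= gh; apply: contrapT => Nt; apply: gh.
    by rewrite /h indicE mem_set// mul1r.
rewrite [leRHS]ge0_integralTE; last by move=> t; rewrite lee_fin.
rewrite [leLHS]ge0_integralTE; last by move=> t; rewrite lee_fin mulr_ge0.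
apply: le_ereal_sup => _ [k /= kh <-]; exists k => //= t.
apply: (le_trans (kh t)); rewrite lee_fin /h indicE.
have [/set_mem Nt|_] := boolP (t \in ~` N); last by rewrite mul0r.
rewrite mul1r; suff -> : f t = `|g t|%R by [].
by apply: contrapT => fgt; apply: Nt; exact: fgN.
Qed.

(** Lower integrals are superadditive but not subadditive in general; the two
    functions of the upper bound are measurable up to a null set, where
    additivity holds. *)
Lemma lower_integral_le_comb (C : R) (f f1 f2 : T -> R) : (0 <= C)%R ->
    (forall t, 0 <= f t)%R -> (forall t, 0 <= f1 t)%R ->
    (forall t, 0 <= f2 t)%R -> ae_measurable f1 -> ae_measurable f2 ->
    {ae mu, forall t, (f t <= C * (f1 t + f2 t))%R} ->
  \int[mu]_t (f t)%:E <=
    C%:E * (\int[mu]_t (f1 t)%:E + \int[mu]_t (f2 t)%:E).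
Proof.
move=> C0 f0 f10 f20 mf1 mf2 ff12.
have [g1 [mg1 g10 fg1 ->]] := ge0_ae_measurable_integral f10 mf1.
have [g2 [mg2 g20 fg2 ->]] := ge0_ae_measurable_integral f20 mf2.
have g1E : measurable_fun setT (EFin \o g1) by exact/measurable_EFinP.
have g2E : measurable_fun setT (EFin \o g2) by exact/measurable_EFinP.
rewrite -ge0_integralD//; first last.
- by move=> t _; rewrite lee_fin.
- by move=> t _; rewrite lee_fin.
rewrite -ge0_integralZl_EFin//; first last.
- exact: emeasurable_funD.
- by move=> t _; rewrite -EFinD lee_fin addr_ge0.
apply: ge0_ae_le_lower_integral.
- by move=> t; rewrite lee_fin.
- by move=> t; rewrite -EFinD -EFinM lee_fin mulr_ge0// addr_ge0.
- apply/measurable_EFinP; apply: measurable_funM => //.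
  exact: measurable_funD.
- apply: filterS3 ff12 fg1 fg2 => t ff12 <- <-.
  by rewrite -EFinD -EFinM lee_fin.
Qed.

Lemma lower_integral_le_mul (C : R) (f f1 : T -> R) : (0 <= C)%R ->
    (forall t, 0 <= f t)%R -> (forall t, 0 <= f1 t)%R -> ae_measurable f1 ->
    {ae mu, forall t, (f t <= C * f1 t)%R} ->
  \int[mu]_t (f t)%:E <= C%:E * \int[mu]_t (f1 t)%:E.
Proof.
move=> C0 f0 f10 mf1 ff1.
have m0 : ae_measurable (fun=> 0%R : R) by exists (fun=> 0%R) => //; exact: aeW.
rewrite -[X in _ <= _ * X]adde0 -[X in _ <= _ * (_ + X)](integral0 mu setT).
apply: lower_integral_le_comb => //.
by apply: filterS ff1 => t; rewrite addr0.
Qed.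

Lemma squeeze_cvg0e (C : R) (u v w : (\bar R)^nat) :
    (forall n, 0 <= w n <= C%:E * (u n + v n)) ->
    u @ \oo --> 0 -> v @ \oo --> 0 -> w @ \oo --> 0.
Proof.
move=> uvw u0 v0.
apply: (@squeeze_cvge _ _ _ _ (cst 0) _ (fun n => C%:E * (u n + v n))).
- by apply: nearW => n; exact: uvw.
- exact: cvg_cst.
- rewrite -[X in _ --> X](mule0 C%:E); apply: cvgeZl => //.
  by rewrite -[X in _ --> X](adde0 0); apply: cvgeD.
Qed.

End lower_integral.

(** * Strong measurability and the Bochner integral *)

Section strong_measurability.
Context d (T : measurableType d) (R : realType).
Variable mu : {measure set T -> \bar R}.
Import HBSimple.
Implicit Types V W : normedModType R.

Lemma simple_strongly_measurable V (s : T -> V) :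
  simple_fun s -> strongly_measurable mu s.
Proof.
by move=> ss; exists (fun=> s); split=> //; apply: aeW => t; exact: cvg_cst.
Qed.

Lemma measurable_strongly_measurable (h : T -> R) :
  measurable_fun setT h -> strongly_measurable mu (h : T -> (R : normedModType R)).
Proof.
move=> mh; have mhE : measurable_fun setT (EFin \o h) by exact/measurable_EFinP.
have [g gh] := approximation_sfun measurableT mhE.
exists (fun n => g n); split.
  move=> n; split; first exact: fimfunP.
  by move=> x; rewrite -[X in measurable X]setTI; exact: measurable_funP.
by apply: aeW => t; have := gh t I => /fine_cvgP[_]; exact.
Qed.

Lemma strongly_measurable_comp V W (phi : W -> V) (u : T -> W) :
  continuous phi -> strongly_measurable mu u -> strongly_measurable mu (phi \o u).
Proof.
move=> cphi [s_ [ss su]]; exists (fun n => phi \o s_ n); split.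
  by move=> n; exact: simple_fun_comp.
apply: filterS su => t st.
exact: (continuous_cvg _ (cphi (u t)) st).
Qed.

Lemma strongly_measurable_pair V W (u : T -> V) (v : T -> W) :
  strongly_measurable mu u -> strongly_measurable mu v ->
  strongly_measurable mu (fun t => (u t, v t) : (V * W)%type).
Proof.
move=> [s_ [ss su]] [q_ [qq qv]].
exists (fun n t => (s_ n t, q_ n t)); split.
  by move=> n; exact: simple_fun_pair.
by apply: filterS2 su qv => t st qt; exact: cvg_pair.
Qed.

Lemma strongly_measurable_lin V (a : R) (u v : T -> V) :
  strongly_measurable mu u -> strongly_measurable mu v ->
  strongly_measurable mu (fun t => u t + a *: v t).
Proof.
move=> su sv.
apply: (@strongly_measurable_comp _ _ (fun w : V * V => w.1 + a *: w.2) _ _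
  (strongly_measurable_pair su sv)) => w.
apply: cvgD; first exact: cvg_fst.
by apply: cvgZr; exact: cvg_snd.
Qed.

Lemma strongly_measurable_scale V (h : T -> R) (u : T -> V) :
  measurable_fun setT h -> strongly_measurable mu u ->
  strongly_measurable mu (fun t => h t *: u t).
Proof.
move=> /measurable_strongly_measurable sh su.
apply: (@strongly_measurable_comp _ _ (fun w : R * V => w.1 *: w.2) _ _
  (strongly_measurable_pair sh su)) => w.
exact: scale_continuous.
Qed.

(** Off a null set N that contains the points without convergence, the distance
    is a pointwise limit of simple real functions. *)
Lemma measurable_norm_off V (u : T -> V) (s_ : nat -> T -> V) (s : T -> V) N :
    (forall n, simple_fun (s_ n)) -> simple_fun s -> measurable N ->
    (forall t, ~ N t -> s_ n t @[n --> \oo] --> u t) ->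
  measurable_fun setT (fun t => (\1_(~` N) t : R) * `|u t - s t|).
Proof.
move=> ss_ ss mN su.
apply: (@measurable_fun_cvg _ _ _ _
    (fun n t => (\1_(~` N) t : R) * `|s_ n t - s t|)) => [n|t _].
  apply: measurable_funM; first by apply: measurable_indic; exact: measurableC.
  exact: (simple_fun_measurable (fun w => `|w.1 - w.2|)
    (simple_fun_pair (ss_ n) ss)).
rewrite indicE; have [/set_mem Nt|_] := boolP (t \in ~` N); last first.
  by under eq_fun do rewrite mul0r; rewrite mul0r; exact: cvg_cst.
under eq_fun do rewrite mul1r; rewrite mul1r.
apply: cvg_norm; apply: cvgB; [exact: su|exact: cvg_cst].
Qed.

Lemma ae_measurable_norm V (u s : T -> V) :
    strongly_measurable mu u -> simple_fun s ->
  ae_measurable mu (fun t => `|u t - s t|).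
Proof.
move=> [s_ [ss_ [N [mN N0 su]]]] ss.
exists (fun t => (\1_(~` N) t : R) * `|u t - s t|).
  apply: (measurable_norm_off ss_) => // t Nt.
  by apply: contrapT => nsu; apply: Nt; exact: su.
exists N; split=> // t /= ne; apply: contrapT => Nt; apply: ne.
by rewrite indicE mem_set// mul1r.
Qed.

Lemma ae_measurable_norm0 V (u : T -> V) :
  strongly_measurable mu u -> ae_measurable mu (fun t => `|u t|).
Proof.
move=> su; have := ae_measurable_norm su (simple_fun_cst T 0).
by under eq_fun do rewrite subr0.
Qed.

Lemma strongly_measurable_ae V (u v : T -> V) : {ae mu, forall t, u t = v t} ->
  strongly_measurable mu u -> strongly_measurable mu v.
Proof.
move=> uv [s_ [ss su]]; exists s_; split => //.
by apply: filterS2 uv su => t ->.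
Qed.

End strong_measurability.

Section bochner_integral.
Context d (T : measurableType d) (R : realType).
Variable mu : {measure set T -> \bar R}.
Implicit Types V W : normedModType R.
Local Open Scope ereal_scope.

Lemma simple_fun_integral_dist V (u s q : T -> V) : strongly_measurable mu u ->
    integrable_simple_fun mu s -> integrable_simple_fun mu q ->
  `|simple_fun_integral mu s - simple_fun_integral mu q|%R%:E <=
    \int[mu]_t `|u t - s t|%R%:E + \int[mu]_t `|u t - q t|%R%:E.
Proof.
move=> su is_ iq; rewrite -[(- simple_fun_integral _ _)%R]scaleN1r.
rewrite -simple_fun_integral_lin//.
apply: (le_trans (simple_fun_integral_norm (integrable_simple_fun_lin _ is_ iq))).
rewrite -[leRHS]mul1e; apply: lower_integral_le_comb => //.
- exact: ae_measurable_norm su is_.1.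
- exact: ae_measurable_norm su iq.1.
apply: aeW => t; rewrite mul1r scaleN1r [leRHS]addrC.
by rewrite -[X in (_ <= _ + X)%R]normrN opprB [leRHS]addrC ler_distD.
Qed.

(** The value of a Bochner integral does not depend on the approximating
    sequence: the integrals of two simple functions differ by at most the sum of
    their distances to u. *)
Lemma bochner_integral_approximation V (u : T -> V) x (q_ : nat -> T -> V) :
    is_bochner_integral mu u x -> (forall n, integrable_simple_fun mu (q_ n)) ->
    \int[mu]_t `|u t - q_ n t|%R%:E @[n --> \oo] --> 0 ->
  simple_fun_integral mu (q_ n) @[n --> \oo] --> x.
Proof.
move=> [su [s_ [is_ s0 sx]]] iq q0.
apply: (cvg_sub0 _ sx); apply/norm_cvg0P.
have /fine_cvgP[] : `|simple_fun_integral mu (q_ n) -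
    simple_fun_integral mu (s_ n)|%R%:E @[n --> \oo] --> 0; last first.
  by move=> _.
apply: (@squeeze_cvg0e _ 1 _ _ _ _ q0 s0) => n.
by rewrite lee_fin normr_ge0/= mul1e; exact: simple_fun_integral_dist.
Qed.

Lemma bochner_integral_lin V (a : R) (u v : T -> V) x y :
    is_bochner_integral mu u x -> is_bochner_integral mu v y ->
  is_bochner_integral mu (fun t => u t + a *: v t)%R (x + a *: y)%R.
Proof.
move=> [su [s_ [is_ s0 sx]]] [sv [q_ [iq q0 qy]]].
split; first exact: strongly_measurable_lin.
exists (fun n t => s_ n t + a *: q_ n t)%R; split.
- by move=> n; exact: integrable_simple_fun_lin.
- apply: (@squeeze_cvg0e _ (1 + `|a|)%R _ _ _ _ s0 q0) => n.
  rewrite integral_ge0//=; apply: lower_integral_le_comb => //.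
  + exact: ae_measurable_norm su (is_ n).1.
  + exact: ae_measurable_norm sv (iq n).1.
  apply: aeW => t; rewrite opprD addrACA -scalerBr.
  rewrite (le_trans (ler_normD _ _))// normrZ mulrDr lerD//.
    by rewrite ler_peMl// lerDl.
  by rewrite ler_wpM2r// lerDr.
- under eq_fun do rewrite simple_fun_integral_lin//.
  by apply: cvgD => //; exact: cvgZr.
Qed.

Lemma bochner_integral_linear V W (L : {linear V -> W}) (C : R) (u : T -> V) x :
    (0 <= C)%R -> (forall v, `|L v| <= C * `|v|)%R ->
  is_bochner_integral mu u x -> is_bochner_integral mu (L \o u) (L x).
Proof.
move=> C0 LC [su [s_ [is_ s0 sx]]].
have cL : continuous L.
  apply: bounded_linear_continuous; apply/linear_boundedP.
  near=> r => v; apply: (le_trans (LC v)); apply: ler_wpM2r => //.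
split; first exact: strongly_measurable_comp.
exists (fun n => L \o s_ n); split.
- by move=> n; apply: integrable_simple_fun_comp; rewrite ?raddf0.
- apply: (@squeeze_cvg0e _ C _ _ _ _ s0 (cvg_cst 0)) => n.
  rewrite integral_ge0//=.
  have mn := ae_measurable_norm su (is_ n).1.
  rewrite adde0; apply: lower_integral_le_mul => //; apply: aeW => t.
  by rewrite -linearB; exact: LC.
- under eq_fun do rewrite simple_fun_integral_linear//.
  exact: (continuous_cvg _ (cL x) sx).
Unshelve. all: by end_near. Qed.

Lemma bochner_integral_norm V (u : T -> V) x : is_bochner_integral mu u x ->
  `|x|%R%:E <= \int[mu]_t `|u t|%R%:E.
Proof.
move=> [su [s_ [is_ s0 sx]]].
have nx : `|simple_fun_integral mu (s_ n)|%R%:E @[n --> \oo] --> `|x|%R%:E.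
  by apply: cvg_EFin; [exact: nearW|exact: cvg_norm].
have [uy|uy] := eqVneq (\int[mu]_t `|u t|%R%:E) +oo; first by rewrite uy leey.
have ufin : \int[mu]_t `|u t|%R%:E \is a fin_num.
  by rewrite ge0_fin_numE ?lt_neqAle ?uy ?leey// integral_ge0.
have us : (\int[mu]_t `|u t - s_ n t|%R%:E + \int[mu]_t `|u t|%R%:E)
    @[n --> \oo] --> \int[mu]_t `|u t|%R%:E.
  rewrite -[X in _ --> X]add0e; apply: cvgeD => //; last exact: cvg_cst.
rewrite -(cvg_lim _ nx)// -(cvg_lim _ us)//; apply: lee_lim.
- by apply: cvgP nx.
- by apply: cvgP us.
apply: nearW => n /=.
apply: (le_trans (simple_fun_integral_norm (is_ n))).
rewrite -[leRHS]mul1e; apply: lower_integral_le_comb => //.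
- exact: ae_measurable_norm su (is_ n).1.
- exact: ae_measurable_norm0.
apply: aeW => t; rewrite mul1r -{1}[s_ n t](subKr (u t)) [leRHS]addrC.
exact: ler_normB.
Qed.

Lemma bochner_integral_ae V (u v : T -> V) x : {ae mu, forall t, u t = v t} ->
  is_bochner_integral mu u x -> is_bochner_integral mu v x.
Proof.
move=> uv [su [s_ [is_ s0 sx]]]; split; first exact: strongly_measurable_ae uv su.
exists s_; split => //.
apply: (@squeeze_cvg0e _ 1 _ _ _ _ s0 s0) => n.
rewrite integral_ge0//=; have mn := ae_measurable_norm su (is_ n).1.
apply: lower_integral_le_comb => //; apply: filterS uv => t <-.
by rewrite mul1r lerDl.
Qed.

End bochner_integral.

Section bochner_existence.
Context d (T : measurableType d) (R : realType).
Variable mu : {measure set T -> \bar R}.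
Implicit Types V W : normedModType R.
Local Open Scope ereal_scope.

Lemma integrable_simple_fun_lty V (s : T -> V) : simple_fun s ->
  \int[mu]_t `|s t|%R%:E < +oo -> integrable_simple_fun mu s.
Proof.
move=> ss sfin; split => // x x0.
have mx : measurable (s @^-1` [set x]) by case: ss.
have nx0 : (0 < `|x|)%R by rewrite normr_gt0.
rewrite -(@lte_pmul2l _ `|x|%:E)// gt0_muley ?lte_fin//.
apply: le_lt_trans sfin.
have -> : mu (s @^-1` [set x]) = \int[mu]_t (\1_(s @^-1` [set x]) t)%:E.
  by rewrite integral_indic ?setIT.
rewrite -ge0_integralZl_EFin//; last exact/measurable_EFinP/measurable_indic.
apply: ge0_le_integral => //.
- by apply/measurable_EFinP/measurable_funM => //; exact: measurable_indic.
- by apply/measurable_EFinP/(simple_fun_measurable (fun v => `|v|%R)).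
move=> t _; rewrite -EFinM lee_fin indicE.
have [/set_mem/= ->|_] := boolP (t \in _); first by rewrite mulr1.
by rewrite mulr0.
Qed.

(** Setting the n-th approximant to zero where it exceeds twice the norm of the
    limit keeps the pointwise convergence and makes it dominated. *)
Lemma bochner_approximation V (u : T -> V) : strongly_measurable mu u ->
    \int[mu]_t `|u t|%R%:E < +oo ->
  exists s_ : nat -> T -> V, (forall n, integrable_simple_fun mu (s_ n)) /\
    \int[mu]_t `|u t - s_ n t|%R%:E @[n --> \oo] --> 0.
Proof.
move=> su ufin; have [s_ [ss [N [mN N0 sN]]]] := su.
have sNu t : ~ N t -> s_ n t @[n --> \oo] --> u t.
  by move=> Nt; apply: contrapT => nsu; apply: Nt; exact: sN.
pose m t := ((\1_(~` N) t : R) * `|u t|)%R.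
have m0 t : (0 <= m t)%R by rewrite mulr_ge0.
have mm : measurable_fun setT m.
  have := measurable_norm_off ss (simple_fun_cst T (0%R : V)) mN sNu.
  by under eq_fun do rewrite subr0.
have mE t : ~ N t -> m t = `|u t|%R.
  by move=> Nt; rewrite /m indicE mem_set// mul1r.
have mfin : \int[mu]_t (m t)%:E < +oo.
  apply: le_lt_trans ufin.
  have [g [mg g0 ug ->]] := ge0_ae_measurable_integral
    (fun t => normr_ge0 (u t)) (ae_measurable_norm0 su).
  apply: ge0_ae_le_lower_integral => //.
  - exact/measurable_EFinP.
  - apply: filterS ug => t <-; rewrite lee_fin /m indicE.
    by case: (_ \in _); rewrite ?mul1r ?mul0r.
pose E n := ~` N `&` [set t | (`|s_ n t| <= 2 * m t)%R].
have mE_ n : measurable (E n).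
  apply: measurableI; first exact: measurableC.
  rewrite -[X in measurable X]setTI; apply: measurable_fun_le => //.
    exact: (simple_fun_measurable (fun v => `|v|%R) (ss n)).
  exact: measurable_funM.
pose q n t := ((\1_(E n) t : R) *: s_ n t)%R.
have sE n : simple_fun (\1_(E n) : T -> (R : normedModType R)).
  exact: simple_fun_indic.
have sq n : simple_fun (q n).
  exact: (simple_fun_comp (fun w : R * V => w.1 *: w.2)%R
    (simple_fun_pair (sE n) (ss n))).
have qm n t : (`|q n t| <= 2 * m t)%R.
  rewrite /q indicE; have [/set_mem[_ st]|_] := boolP (t \in E n).
    by rewrite scale1r.
  by rewrite scale0r normr0 mulr_ge0.
have qu t : ~ N t -> q n t @[n --> \oo] --> u t.
  move=> Nt; have [u0|u0] := eqVneq (u t) 0%R.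
    have q0 n : q n t = 0%R.
      by apply/eqP; rewrite -normr_le0 (le_trans (qm n t))// mE// u0 normr0 mulr0.
    by under eq_fun do rewrite q0; rewrite u0; exact: cvg_cst.
  apply: cvg_trans (sNu t Nt); apply: near_eq_cvg; near=> n.
  rewrite /q indicE mem_set ?scale1r//; split=> //=; rewrite mE//.
  near: n; apply: (cvgr_le (`|u t|)%R (cvg_norm (sNu t Nt))).
  by rewrite ltr_pMl ?normr_gt0// ltr1n.
have iq n : integrable_simple_fun mu (q n).
  apply: integrable_simple_fun_lty => //.
  apply: (@le_lt_trans _ _ (\int[mu]_t (2 * m t)%:E)).
    apply: ge0_le_integral => //.
    - exact/measurable_EFinP/(simple_fun_measurable (fun v => `|v|%R)).
    - by apply/measurable_EFinP; exact: measurable_funM.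
    - by move=> t _; rewrite lee_fin.
  under eq_integral do rewrite EFinM.
  rewrite ge0_integralZl_EFin//; [|by move=> t _; rewrite lee_fin|]; last first.
    exact/measurable_EFinP.
  by rewrite lte_mul_pinfty.
exists q; split=> //.
pose dist n t := ((\1_(~` N) t : R) * `|u t - q n t|)%R.
have mdist n : measurable_fun setT (dist n).
  exact: (measurable_norm_off ss (sq n) mN sNu).
have dist0 n t : (0 <= dist n t)%R by rewrite mulr_ge0.
apply: (@squeeze_cvg0e _ 1 (fun n => \int[mu]_t (dist n t)%:E) (cst 0)) => [n||].
- rewrite integral_ge0//= mul1e adde0.
  apply: ge0_ae_le_lower_integral => //.
  + by move=> t; rewrite lee_fin.
  + exact/measurable_EFinP.
  + exists N; split=> // t /= ne; apply: contrapT => Nt; apply: ne.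
    by rewrite /dist indicE mem_set// mul1r.
- have [] := @dominated_convergence _ _ _ mu _ measurableT
    (fun n t => (dist n t)%:E) (cst 0) (fun t => (3 * m t)%:E).
  + by move=> n; exact/measurable_EFinP.
  + exact: measurable_cst.
  + apply: aeW => t _ /=; apply: cvg_EFin; first exact: nearW.
    rewrite /dist indicE; have [/set_mem Nt|_] := boolP (t \in ~` N).
      rewrite -[X in _ --> X](@normr0 _ V) -(subrr (u t)).
      under eq_fun do rewrite mul1r.
      by apply: cvg_norm; apply: cvgB; [exact: cvg_cst|exact: qu].
    by under eq_fun do rewrite mul0r; exact: cvg_cst.
  + apply/integrableP; split.
      by apply/measurable_EFinP; exact: measurable_funM.
    under eq_integral do rewrite /= ger0_norm ?mulr_ge0// EFinM.
    rewrite ge0_integralZl_EFin//; [|by move=> t _; rewrite lee_fin|]; last first.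
      exact/measurable_EFinP.
    by rewrite lte_mul_pinfty.
  + apply: aeW => t n _; rewrite /= lee_fin ger0_norm//.
    rewrite /dist indicE; have [/set_mem Nt|_] := boolP (t \in ~` N).
      rewrite mul1r (le_trans (ler_normB _ _))// -(mE t Nt).
      by have := qm n t; lra.
    by rewrite mul0r mulr_ge0.
  + move=> _ + _; under eq_fun do under eq_integral do
      rewrite sube0 gee0_abs ?lee_fin//.
    exact.
- exact: cvg_cst.
Unshelve. all: by end_near. Qed.

Lemma bochner_integral_exists (V : completeNormedModType R) (u : T -> V) :
    strongly_measurable mu u -> \int[mu]_t `|u t|%R%:E < +oo ->
  exists x, is_bochner_integral mu u x.
Proof.
move=> su ufin; have [s_ [is_ s0]] := bochner_approximation su ufin.
suff /cvg_ex[x sx] : cvgn (fun n => simple_fun_integral mu (s_ n)).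
  by exists x; split=> //; exists s_.
apply/cauchy_cvgP/cauchy_exP => e e0.
have e2 : (0 < e / 2)%R by rewrite divr_gt0.
have near_s : \forall n \near \oo, \int[mu]_t `|u t - s_ n t|%R%:E < (e / 2)%:E.
  have /fine_cvgP[sfin /cvgrPdist_lt /(_ _ e2) se] := s0.
  apply: filterS2 sfin se => n nfin; rewrite /= sub0r normrN ger0_norm.
    by rewrite -lte_fin fineK.
  by rewrite fine_ge0// integral_ge0.
have [n0 _ n0P] := near_s.
exists (simple_fun_integral mu (s_ n0)); exists n0 => // n /n0P sn.
rewrite /= -ball_normE/= -lte_fin.
apply: (le_lt_trans (simple_fun_integral_dist su (is_ n0) (is_ n))).
by rewrite [e]splitr EFinD lteD// n0P/=.
Qed.

End bochner_existence.

(** * Restriction of a measure as multiplication by an indicator *)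

Section restriction.
Context d (T : measurableType d) (R : realType).
Variables (mu nu : {measure set T -> \bar R}) (D : set T).
Hypothesis mD : measurable D.
Hypothesis nuE : forall A, measurable A -> nu A = mu (A `&` D).
Implicit Types V : normedModType R.
Local Open Scope ereal_scope.

Lemma ae_restriction (P : T -> Prop) :
  {ae nu, forall t, P t} <-> {ae mu, forall t, D t -> P t}.
Proof.
split=> -[N [mN N0 PN]].
  exists (N `&` D); split; [exact: measurableI|by rewrite -nuE|].
  move=> t /= /not_implyP[Dt Pt]; split=> //; exact: PN.
exists (N `|` ~` D); split; first by apply: measurableU => //; exact: measurableC.
  rewrite nuE; last by apply: measurableU => //; exact: measurableC.
  rewrite setIUl setICl setU0; apply/eqP; rewrite eq_le measure_ge0 andbT -N0.
  by apply: le_measure; rewrite ?inE//; exact: measurableI.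
move=> t /= Pt; have [Dt|Dt] := pselect (D t); last by right.
by left; apply: PN => /= /(_ Dt).
Qed.

Lemma ge0_integral_restriction (m : T -> R) :
    measurable_fun setT m -> (forall t, 0 <= m t)%R ->
  \int[nu]_t (m t)%:E = \int[mu]_t ((\1_D t : R) * m t)%R%:E.
Proof.
move=> mm m0.
have mmE : measurable_fun setT (fun t => (m t)%:E) by exact/measurable_EFinP.
rewrite (@ge0_negligible_integral _ _ _ nu setT (~` D))//; first last.
- by rewrite nuE ?setICl ?measure0//; exact: measurableC.
- by move=> t _; rewrite lee_fin.
- exact: measurableC.
rewrite setDE setCK setTI (@eq_measure_integral _ _ _ D mu nu).
  rewrite integral_mkcond; apply: eq_integral => t _; rewrite patchE indicE.
  by case: ifPn => _; rewrite ?mul1r ?mul0r.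
by move=> A mA AD; rewrite nuE// setIidl.
Qed.

Lemma simple_fun_restrict V (s : T -> V) :
  simple_fun s -> simple_fun (fun t => (\1_D t : R) *: s t)%R.
Proof.
move=> ss.
have s1D : simple_fun (\1_D : T -> (R : normedModType R)).
  exact: simple_fun_indic.
exact: (simple_fun_comp (fun w : R * V => w.1 *: w.2)%R
  (simple_fun_pair s1D ss)).
Qed.

Lemma restrict_preimage V (s : T -> V) x : x != 0%R ->
  (fun t => (\1_D t : R) *: s t)%R @^-1` [set x] = s @^-1` [set x] `&` D.
Proof.
move=> x0; apply/seteqP; split=> t /=; rewrite indicE.
  have [/set_mem Dt|_] := boolP (t \in D); first by rewrite scale1r.
  by rewrite scale0r => /esym/eqP; rewrite (negbTE x0).
by move=> [sx Dt]; rewrite mem_set// scale1r.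
Qed.

Lemma integrable_simple_fun_restriction V (s : T -> V) : simple_fun s ->
  integrable_simple_fun nu s <->
  integrable_simple_fun mu (fun t => (\1_D t : R) *: s t)%R.
Proof.
move=> ss; split=> -[_ sfin]; split=> //.
- exact: simple_fun_restrict.
- by move=> x x0; rewrite restrict_preimage// -nuE ?sfin//; case: ss.
- by move=> x x0; rewrite nuE -?restrict_preimage ?sfin//; case: ss.
Qed.

Lemma simple_fun_integral_restriction V (s : T -> V) : simple_fun s ->
  simple_fun_integral nu s =
  simple_fun_integral mu (fun t => (\1_D t : R) *: s t)%R.
Proof.
move=> ss; apply: eq_fsbigr => x /set_mem/= /eqP x0.
by rewrite restrict_preimage// nuE//; case: ss.
Qed.

Lemma strongly_measurable_restriction V (u : T -> V) :
  strongly_measurable nu u <->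
  strongly_measurable mu (fun t => (\1_D t : R) *: u t)%R.
Proof.
split=> -[s_ [ss su]].
  move/ae_restriction in su; exists (fun n t => (\1_D t : R) *: s_ n t)%R; split.
    by move=> n; exact: simple_fun_restrict.
  apply: filterS su => t su; rewrite indicE.
  have [/set_mem Dt|_] := boolP (t \in D).
    by under eq_fun do rewrite scale1r; rewrite scale1r; exact: su.
  by under eq_fun do rewrite scale0r; rewrite scale0r; exact: cvg_cst.
exists s_; split=> //; apply/ae_restriction; apply: filterS su => t su Dt.
by move: su; rewrite indicE mem_set// scale1r.
Qed.

(** All integrals below are taken for one measure on the whole line: an integral
    over a subset becomes the integral of a truncated function, so that
    integrals over different intervals can be added. *)
Lemma bochner_integral_restriction V (u : T -> V) x :
  is_bochner_integral nu u x <->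
  is_bochner_integral mu (fun t => (\1_D t : R) *: u t)%R x.
Proof.
have m1D : measurable_fun setT (\1_D : T -> R) by exact: measurable_indic.
have norm_off t v w : (`|(\1_D t : R) *: v - (\1_D t : R) *: w| =
    (\1_D t : R) * `|v - w : V|)%R.
  by rewrite -scalerBr normrZ ger0_norm.
split=> -[su [s_ [is_ s0 sx]]].
- split; first exact/strongly_measurable_restriction.
  exists (fun n t => (\1_D t : R) *: s_ n t)%R; split.
  + by move=> n; apply/integrable_simple_fun_restriction => //; case: (is_ n).
  + apply: (@squeeze_cvg0e _ 1 _ _ _ _ s0 (cvg_cst 0)) => n.
    rewrite integral_ge0//= mul1e adde0.
    have [m [mm m0 sm ->]] := ge0_ae_measurable_integral
      (fun t => normr_ge0 (u t - s_ n t)%R) (ae_measurable_norm su (is_ n).1).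
    rewrite ge0_integral_restriction//.
    apply: ge0_ae_le_lower_integral => //.
    * by move=> t; rewrite lee_fin mulr_ge0.
    * by apply/measurable_EFinP; exact: measurable_funM.
    move/ae_restriction in sm; apply: filterS sm => t sm.
    rewrite norm_off lee_fin indicE.
    by have [/set_mem/sm ->|_] := boolP (t \in D); rewrite ?mul0r.
  + apply: cvg_trans sx; apply: near_eq_cvg; apply: nearW => n.
    by rewrite simple_fun_integral_restriction//; case: (is_ n).
- have iq n : integrable_simple_fun mu (fun t => (\1_D t : R) *: s_ n t)%R.
    have [[_ sm] sfin] := is_ n; split.
      by apply: simple_fun_restrict; case: (is_ n).
    move=> y y0; rewrite restrict_preimage//; apply: le_lt_trans (sfin y y0).
    by apply: le_measure; rewrite ?inE//; exact: measurableI.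
  have ssn n : simple_fun (s_ n) by case: (is_ n).
  split; first exact/strongly_measurable_restriction.
  exists s_; split.
  + by move=> n; apply/integrable_simple_fun_restriction.
  + apply: (@squeeze_cvg0e _ 1 _ _ _ _ s0 (cvg_cst 0)) => n.
    rewrite integral_ge0//= mul1e adde0.
    have [m [mm m0 sm ->]] := ge0_ae_measurable_integral
      (fun t => normr_ge0 ((\1_D t : R) *: u t - s_ n t)%R)
      (ae_measurable_norm su (ssn n)).
    apply: (@le_trans _ _ (\int[nu]_t (m t)%:E)).
      apply: ge0_ae_le_lower_integral => //.
      * exact/measurable_EFinP.
      apply/ae_restriction; apply: filterS sm => t + Dt.
      by rewrite indicE mem_set// scale1r => ->.
    rewrite ge0_integral_restriction//; apply: ge0_le_integral => //.
    * by move=> t _; rewrite lee_fin mulr_ge0.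
    * by apply/measurable_EFinP; exact: measurable_funM.
    * exact/measurable_EFinP.
    * move=> t _; rewrite lee_fin indicE.
      by case: (t \in D); rewrite ?mul1r ?mul0r.
  + under eq_fun do rewrite simple_fun_integral_restriction//.
    apply: (bochner_integral_approximation (conj su _) iq); first by exists s_.
    apply: (@squeeze_cvg0e _ 1 _ _ _ _ s0 (cvg_cst 0)) => n.
    rewrite integral_ge0//=.
    have mn := ae_measurable_norm su (ssn n).
    rewrite adde0; apply: lower_integral_le_mul => //; apply: aeW => t.
    rewrite mul1r indicE; case: (t \in D); first by rewrite !scale1r.
    by rewrite !scale0r subr0 normr0.
Qed.

End restriction.

Section bochner_indicator.
Context d (T : measurableType d) (R : realType).
Variable mu : {measure set T -> \bar R}.
Implicit Types V : normedModType R.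

Lemma bochner_integral_indic V (A : set T) (x : V) :
    measurable A -> (mu A < +oo)%E ->
  is_bochner_integral mu (fun t => (\1_A t : R) *: x) (fine (mu A) *: x).
Proof.
move=> mA Afin.
have s1 : simple_fun (\1_A : T -> (R : normedModType R)).
  exact: simple_fun_indic.
have preim1 : \1_A @^-1` [set 1 : R] = A.
  apply/seteqP; split=> t /=; rewrite indicE; last by move=> ?; rewrite mem_set.
  by have [/set_mem//|_ /eqP] := boolP (t \in A); rewrite eq_sym oner_eq0.
have i1 : integrable_simple_fun mu (\1_A : T -> (R : normedModType R)).
  split=> // r r0; have [->|r1] := eqVneq r 1; first by rewrite preim1.
  rewrite (_ : _ @^-1` _ = set0) ?measure0//; apply/seteqP; split=> // t /=.
  rewrite indicE; case: (t \in A) => /= /esym/eqP; last by rewrite (negbTE r0).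
  by rewrite (negbTE r1).
have scale0x : (0 : R) *: x = 0 by rewrite scale0r.
have ix := @integrable_simple_fun_comp _ _ _ mu V _ _ (fun r : R => r *: x)
  scale0x i1.
split; first exact: simple_strongly_measurable ix.1.
exists (fun=> fun t => (\1_A t : R) *: x); split=> //.
- under eq_fun do under eq_integral do rewrite subrr normr0.
  by under eq_fun do rewrite integral0; exact: cvg_cst.
- have -> : simple_fun_integral mu (fun t => (\1_A t : R) *: x) =
      fine (mu A) *: x.
    rewrite (@simple_fun_integral_comp _ _ _ mu V _ _ (fun r : R => r *: x)
      [:: 0; 1] scale0x i1)//.
    + by rewrite 2!big_cons big_nil eqxx oner_eq0/= scale1r addr0 preim1.
    + by rewrite /= inE eq_sym oner_eq0.
    + by move=> t; rewrite indicE !inE; case: (t \in A); rewrite eqxx ?orbT.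
  exact: cvg_cst.
Qed.

End bochner_indicator.

(** * Lower derivatives of monotone functions *)

Section derivative_bound.
Context {R : realType}.
Local Notation leb := (@lebesgue_measure R).
Local Open Scope ereal_scope.

Lemma lebesgue_measure_translation (h : R) (A : set R) : measurable A ->
  pushforward leb ((fun x => x + h)%R : _ -> measurableTypeR R) A = leb A.
Proof.
move=> mA; apply/esym/lebesgue_measure_unique => //=.
  exact: measurable_funD.
move=> _ _ [[a b]] _ <-.
rewrite /pushforward /= (_ : _ @^-1` _ = `](a - h)%R, (b - h)%R]%classic).
  by rewrite !lebesgue_measure_itv/= !lte_fin ltrD2r -!EFinD opprB addrA subrK.
by apply/seteqP; split=> x /=; rewrite !in_itv/= ltrBlDr lerBrDr.
Qed.

Lemma ge0_integral_translation (h : R) (f : R -> R) (D : set R) :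
    measurable D -> measurable_fun setT f -> (forall x, 0 <= f x)%R ->
  \int[leb]_(x in (fun x => x + h)%R @^-1` D) (f (x + h)%R)%:E =
  \int[leb]_(x in D) (f x)%:E.
Proof.
move=> mD mf f0.
have mfD : measurable_fun D (EFin \o f).
  by apply/measurable_EFinP; exact: measurable_funS mf.
have mh : measurable_fun setT
    ((fun x => x + h)%R : measurableTypeR R -> measurableTypeR R).
  exact: measurable_funD.
rewrite -(@ge0_integral_pushforward _ _ _ _ _ _ mh leb D (EFin \o f))//.
- apply: eq_measure_integral => A mA _.
  exact: (lebesgue_measure_translation h mA).
- by move=> y _; rewrite /= lee_fin.
Qed.

(** The integral of the increment telescopes by translation invariance: the
    integral of F over an interval of length h to the right of 1 remains. *)
Lemma integral_increment_le (F : R -> R) (h : R) :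
    {homo F : x y / (x <= y)%R} -> (forall x, 0 <= F x)%R -> (0 < h <= 1)%R ->
  \int[leb]_(x in `]0%R, 1%R[) (F (x + h) - F x)%R%:E <= (h * F 2)%R%:E.
Proof.
move=> Fhomo F0 /andP[h0 h1].
have mF : measurable_fun setT F by exact: nondecreasing_measurable.
have mFh : measurable_fun setT (fun x : R => F (x + h)%R).
  apply: nondecreasing_measurable => // x y xy.
  by apply: Fhomo; rewrite lerD2r.
have dF0 x : (0 <= F (x + h) - F x)%R by rewrite subr_ge0 Fhomo// lerDl ltW.
have m01 : measurable (`]0%R, 1%R[%classic : set R) by [].
have IF_fin : \int[leb]_(x in `]0%R, 1%R[) (F x)%:E \is a fin_num.
  rewrite ge0_fin_numE; last by apply: integral_ge0 => x _; rewrite lee_fin.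
  apply: (@le_lt_trans _ _ (\int[leb]_(x in `]0%R, 1%R[) (F 1%R)%:E)).
    apply: ge0_le_integral => //.
    - by move=> x _; rewrite lee_fin.
    - by apply/measurable_EFinP; exact: measurable_funS mF.
    - by move=> x /=; rewrite in_itv/= lee_fin => /andP[_ /ltW]; exact: Fhomo.
  rewrite integral_cst//= lebesgue_measure_itv/= lte_fin ltr01 sube0 mule1.
  by rewrite ltry.
rewrite -(leeD2rE _ _ IF_fin) -ge0_integralD//; first last.
- by apply/measurable_EFinP; exact: measurable_funS mF.
- by move=> x _; rewrite lee_fin.
- by apply/measurable_EFinP/measurable_funB; apply: (@measurable_funS _ _ _ _ setT).
- by move=> x _; rewrite lee_fin.
under eq_integral do rewrite -EFinD subrK.
rewrite (_ : `]0%R, 1%R[%classic = (fun x => x + h)%R @^-1` `]h, (1 + h)%R[); last first.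
  by apply/seteqP; split=> x /=; rewrite !in_itv/= ltrDr ltrD2r.
rewrite ge0_integral_translation//.
rewrite -[X in _ + X](_ : \int[leb]_(x in `]0%R, 1%R[) (F x)%:E = _); last first.
  congr (integral _ _ _).
  by apply/seteqP; split=> x /=; rewrite !in_itv/= ltrDr ltrD2r.
have m1h : measurable (`[1%R, (1 + h)%R[%classic : set R) by [].
apply: (@le_trans _ _ (\int[leb]_(x in `]0%R, 1%R[ `|` `[1%R, (1 + h)%R[) (F x)%:E)).
  apply: ge0_subset_integral => //.
  - exact: measurableU.
  - by apply/measurable_EFinP; exact: measurable_funS mF.
  - by move=> x _; rewrite lee_fin.
  - move=> x /=; rewrite !in_itv/= => /andP[hx xh].
    have [x1|x1] := ltP x 1%R; [left|right]; rewrite ?xh ?andbT//.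
    exact: lt_trans hx.
rewrite ge0_integral_setU//; first last.
- rewrite disj_set2E; apply/eqP; rewrite -subset0 => x /= [].
  by rewrite !in_itv/= => /andP[_ x1] /andP[]; rewrite leNgt x1.
- by move=> x _; rewrite lee_fin.
- by apply/measurable_EFinP; exact: measurable_funS mF.
rewrite addeC leeD2r//.
apply: (@le_trans _ _ (\int[leb]_(x in `[1%R, (1 + h)%R[) (F 2)%:E)).
  apply: ge0_le_integral => //.
  - by move=> x _; rewrite lee_fin.
  - by apply/measurable_EFinP; exact: measurable_funS mF.
  - move=> x /=; rewrite in_itv/= lee_fin => /andP[_ xh]; apply: Fhomo.
    by rewrite (le_trans (ltW xh))// -[2%R]/(1 + 1)%R lerD2l.
rewrite integral_cst//= lebesgue_measure_itv/= lte_fin ltrDl h0 -EFinB.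
by rewrite [(1 + h)%R]addrC addrK -EFinM mulrC.
Qed.

Definition increment_quotient (F : R -> R) (x : R) (n : nat) : R :=
  (n.+1%:R * (F (x + n.+1%:R^-1) - F x))%R.

(** The lower limit over the increments 1 / (n + 1) is measurable for monotone F
    and defined everywhere, so that no almost everywhere differentiability is
    involved. *)
Definition lower_derivative (F : R -> R) (x : R) : \bar R :=
  limn_einf (fun n => (increment_quotient F x n)%:E).

Lemma increment_quotient_ge0 (F : R -> R) x n :
  {homo F : x y / (x <= y)%R} -> (0 <= increment_quotient F x n)%R.
Proof. by move=> Fh; rewrite mulr_ge0// subr_ge0 Fh// lerDl. Qed.

Lemma measurable_increment_quotient (F : R -> R) n :
  {homo F : x y / (x <= y)%R} ->
  measurable_fun setT (fun x : R => increment_quotient F x n).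
Proof.
move=> Fh; apply: measurable_funM => //; apply: measurable_funB.
  apply: nondecreasing_measurable => // x y xy.
  by apply: Fh; rewrite lerD2r.
exact: nondecreasing_measurable.
Qed.

Lemma measurable_lower_derivative (F : R -> R) :
  {homo F : x y / (x <= y)%R} -> measurable_fun setT (lower_derivative F).
Proof.
move=> Fh; apply: measurableT_comp => //; apply: measurable_fun_limn_esup => n.
by apply: measurableT_comp => //; apply/measurable_EFinP;
  exact: measurable_increment_quotient.
Qed.

Lemma lower_derivative_ge0 (F : R -> R) x :
  {homo F : x y / (x <= y)%R} -> 0 <= lower_derivative F x.
Proof.
move=> Fh; rewrite /lower_derivative limn_einf_lim.
apply: lime_ge; first exact: is_cvg_einfs.
apply: nearW => n; apply: le_ereal_inf_tmp => _ [m _ <-].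
by rewrite lee_fin increment_quotient_ge0.
Qed.

(** One half of the fundamental theorem of calculus for monotone functions, by
    Fatou's lemma. *)
Lemma integral_lower_derivative_le (F : R -> R) :
    {homo F : x y / (x <= y)%R} -> (forall x, 0 <= F x)%R ->
  \int[leb]_(x in `]0%R, 1%R[) lower_derivative F x <= (F 2)%:E.
Proof.
move=> Fh F0; have mq n := measurable_increment_quotient n Fh.
apply: (le_trans (fatou _ _ _ _)) => //.
- by move=> n; apply/measurable_EFinP; exact: measurable_funS (mq n).
- by move=> n x _; rewrite lee_fin increment_quotient_ge0.
rewrite limn_einf_lim; apply: lime_le; first exact: is_cvg_einfs.
apply: nearW => n; apply: (@le_trans _ _
  (\int[leb]_(x in `]0%R, 1%R[) (increment_quotient F x n)%:E)).
  by apply: ereal_inf_lbound; exists n => //=.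
have n0 : (0 < n.+1%:R :> R)%R by rewrite ltr0n.
under eq_integral do rewrite /increment_quotient EFinM.
rewrite ge0_integralZl_EFin//; first last.
- apply/measurable_EFinP/measurable_funB.
    apply: nondecreasing_measurable => // x y xy.
    by apply: Fh; rewrite lerD2r.
  exact: nondecreasing_measurable.
- by move=> x _; rewrite lee_fin subr_ge0 Fh// lerDl.
rewrite -lee_pdivlMl// -EFinM; apply: integral_increment_le => //.
by rewrite invr_gt0 n0 invf_le1// ler1n.
Qed.

End derivative_bound.

Section reciprocal.
Context {R : realType}.
Implicit Types (B : R -> R).

(** The value 0 on ]-oo, 0] makes the reciprocal of a positive nonincreasing B
    monotone on the whole line. *)
Definition reciprocal B (x : R) : R := if 0 < x then (B x)^-1 else 0.

Lemma reciprocal_ge0 B x : (forall x : R, 0 < x -> 0 < B x) -> 0 <= reciprocal B x.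
Proof.
by move=> B0; rewrite /reciprocal; case: ifP => // x0; rewrite invr_ge0 ltW// B0.
Qed.

Lemma reciprocal_homo B : (forall x : R, 0 < x -> 0 < B x) ->
    (forall x y : R, 0 < x -> x <= y -> B y <= B x) ->
  {homo reciprocal B : x y / x <= y}.
Proof.
move=> B0 Bni x y xy; rewrite {1}/reciprocal.
case: ifPn => [x0|_]; last exact: reciprocal_ge0.
have y0 := lt_le_trans x0 xy.
by rewrite /reciprocal y0 lef_pV2 ?posrE ?B0// Bni.
Qed.

(** The derivative is 0 by default at a point without derivative. *)
Lemma derive1_neq0_cvg (B : R -> R) x : derive1 B x != 0 ->
  h^-1 *: (B (h + x) - B x) @[h --> 0^'] --> derive1 B x.
Proof.
move=> d0; apply: contrapT => ncv; move: d0.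
rewrite /derive1 dvgP ?eqxx// => cv; apply: ncv; exact: cv.
Qed.

Lemma lower_derivative_reciprocal B x : (forall x : R, 0 < x -> 0 < B x) ->
    (forall x y : R, 0 < x -> x <= y -> B y <= B x) -> 0 < x ->
    derive1 B x != 0 ->
  derive1 B x < 0 /\
  lower_derivative (reciprocal B) x = (- derive1 B x / B x ^+ 2)%:E.
Proof.
move=> B0 Bni x0 d0; set d := derive1 B x in d0 *.
pose q n : R := n.+1%:R * (B (x + n.+1%:R^-1) - B x).
have qd : q @ \oo --> d.
  have h0 : (harmonic : nat -> R) @ \oo --> 0^'.
    move=> A [e /= e0 eA]; have /cvgrPdist_lt /(_ e e0) := @cvg_harmonic R.
    apply: filterS => n hn; apply: eA; first exact: hn.
    by rewrite /= gt_eqF// invr_gt0 ltr0n.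
  have := cvg_comp _ _ h0 (derive1_neq0_cvg d0).
  apply: cvg_trans; apply: near_eq_cvg; apply: nearW => n /=.
  by rewrite /q invrK [x + _]addrC.
have BB : B (x + n.+1%:R^-1) @[n --> \oo] --> B x.
  have : (n.+1%:R^-1 * q n + B x) @[n --> \oo] --> 0 * d + B x.
    by apply: cvgD; [apply: cvgM => //; exact: cvg_harmonic|exact: cvg_cst].
  rewrite mul0r add0r.
  apply: cvg_trans; apply: near_eq_cvg.
  by apply: nearW => n; rewrite /= /q mulrA mulVf ?pnatr_eq0// mul1r subrK.
have d_le0 : d <= 0.
  apply: (cvgr_to_le qd); apply: nearW => n.
  by rewrite pmulr_rle0 ?ltr0n// subr_le0 Bni// lerDl.
split; first by rewrite lt_neqAle d0.
suff cv : (increment_quotient (reciprocal B) x n)%:E @[n --> \oo] -->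
    (- d / B x ^+ 2)%:E.
  by rewrite /lower_derivative; have [-> _] := cvg_limn_einf_sup cv.
apply: cvg_EFin; first exact: nearW.
have : (- q n * (B (x + n.+1%:R^-1) * B x)^-1) @[n --> \oo] --> - d / B x ^+ 2.
  apply: cvgM; first exact: cvgN.
  rewrite expr2; apply: cvgV; first by rewrite mulf_neq0// gt_eqF// B0.
  by apply: cvgM => //; exact: cvg_cst.
apply: cvg_trans; apply: near_eq_cvg; apply: nearW => n /=.
have xn0 : 0 < x + n.+1%:R^-1 by rewrite addr_gt0// invr_gt0 ltr0n.
rewrite /increment_quotient /reciprocal x0 xn0 /q.
have := B0 _ x0; have := B0 _ xn0.
set a := B (_ + _); set b := B x => a0 b0.
by field; rewrite !gt_eqF.
Qed.

End reciprocal.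

(** * Essential bounds and equality of spaces *)

Section essential_bounds.
Context {R : realType}.
Local Notation leb := (@lebesgue_measure R).
Local Open Scope ereal_scope.

Lemma ae_lebesgue_on (i : interval R) (P : R -> Prop) :
  {ae lebesgue_on i, forall t, P t} <-> {ae leb, forall t, t \in i -> P t}.
Proof. exact: (@ae_restriction _ _ _ leb (lebesgue_on i) [set` i]). Qed.

Lemma Linf_norm_ge0 (i : interval R) (f : R -> \bar R) : 0 <= Linf_norm i f.
Proof. exact: Lnorm_ge0. Qed.

Lemma Linf_norm_leP (i : interval R) (f : R -> \bar R) y : 0 <= y ->
  Linf_norm i f <= y <-> {ae leb, forall t, t \in i -> `|f t| <= y}.
Proof.
move=> y0; rewrite -ae_lebesgue_on /Linf_norm unlock.
case: ifPn => [_|]; first by split => /ess_supP.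
rewrite -leNgt => i0; split=> // _; exists setT; split=> //.
by apply/eqP; rewrite eq_le i0 measure_ge0.
Qed.

(** The filter of almost everywhere true properties on the line is not inferred
    for predicates on R; these two lemmas supply it. *)
Lemma lebesgue_aeS (P Q : R -> Prop) : (forall t, P t -> Q t) ->
  {ae leb, forall t, P t} -> {ae leb, forall t, Q t}.
Proof.
by apply: (@filterS _ _ (ae_filter_ringOfSetsType (@lebesgue_measure R))).
Qed.

Lemma lebesgue_aeI (P Q : R -> Prop) : {ae leb, forall t, P t} ->
  {ae leb, forall t, Q t} -> {ae leb, forall t, P t /\ Q t}.
Proof.
by apply: (@filterI _ _ (ae_filter_ringOfSetsType (@lebesgue_measure R))).
Qed.

Lemma ae_itv_ex (a b : R) (P : R -> Prop) : (a < b)%R ->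
  {ae leb, forall t, P t} -> exists2 t, t \in `]a, b[ & P t.
Proof.
move=> ab [N [mN N0 PN]]; apply: contrapT => nP.
have : leb `]a, b[ <= leb N.
  apply: le_measure; rewrite ?inE// => t tab; apply: PN => /= Pt.
  by apply: nP; exists t.
by rewrite N0 lebesgue_measure_itv/= lte_fin ab -EFinD lee_fin subr_le0 leNgt ab.
Qed.

End essential_bounds.

Lemma equal_spaces_bound (R : realType) (E : Type) (N N' : E -> \bar R) (C : R) :
    0 < C -> (forall f, 0 <= N f)%E -> (forall f, 0 <= N' f)%E ->
    (forall f, N f <= C%:E * N' f)%E -> (forall f, N' f <= C%:E * N f)%E ->
  equal_spaces N N'.
Proof.
move=> C0 N0 N'0 NN' N'N; split; last by exists C.
apply/seteqP; split=> f /= fin.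
  by apply: (le_lt_trans (N'N f)); rewrite lte_mul_pinfty// lee_fin ltW.
by apply: (le_lt_trans (NN' f)); rewrite lte_mul_pinfty// lee_fin ltW.
Qed.

(** * The K-spaces *)

Section K_spaces.
Context {R : realType} (c : compatible_couple R).
Implicit Types (f : sum_space c) (t : R).

Lemma K_functional_has_inf f t : 0 <= t ->
  has_inf [set `|p.1| + t * `|p.2| | p in decompositions f].
Proof.
move=> t0; split; last by exists 0 => _ [p _ <-]; rewrite addr_ge0// mulr_ge0.
have /asboolP[x0 [x1 zE]] := sum_valP f.
by exists (`|x0| + t * `|x1|); exists (x0, x1).
Qed.

Lemma K_functional_le f t x0 x1 : 0 <= t ->
  sum_val f = emb0 c x0 + emb1 c x1 -> K_functional f t <= `|x0| + t * `|x1|.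
Proof.
move=> t0 fE; apply: ge_inf; first by have [] := K_functional_has_inf f t0.
by exists (x0, x1).
Qed.

Lemma le_K_functional f t y : 0 <= t ->
    (forall x0 x1, sum_val f = emb0 c x0 + emb1 c x1 -> y <= `|x0| + t * `|x1|) ->
  y <= K_functional f t.
Proof.
move=> t0 yle; apply: lb_le_inf; first by have [] := K_functional_has_inf f t0.
by move=> _ [[x0 x1] fE <-]; exact: yle.
Qed.

Lemma K_functional_ge0 f t : 0 <= t -> 0 <= K_functional f t.
Proof. by move=> t0; apply: le_K_functional => // *; rewrite addr_ge0// mulr_ge0. Qed.

Lemma K_functional_homo f s t : 0 <= s -> s <= t ->
  K_functional f s <= K_functional f t.
Proof.
move=> s0 st; apply: le_K_functional => [|x0 x1 fE]; first exact: le_trans st.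
by apply: (le_trans (K_functional_le s0 fE)); rewrite lerD2l ler_wpM2r.
Qed.

Lemma K_norm_ge0 v i f : (0 <= K_norm c v i f)%E.
Proof. exact: Linf_norm_ge0. Qed.

(** An element of the K-space on ]1, +oo[ has v K bounded at some point of
    ]1, 2[, which bounds K at 1 by monotonicity, hence v K on ]0, 1]. *)
Lemma K_equal_spaces (v : R -> R) (C : R) : 0 <= C ->
    (forall t, 0 < t -> 0 < v t) -> (forall t, 1 < t -> t < 2 -> v 2 <= v t) ->
    (forall f t, 0 < t -> t <= 1 ->
      v t * K_functional f t <= C * K_functional f 1) ->
  equal_spaces (K_norm c (EFin \o v) `]0, +oo[) (K_norm c (EFin \o v) `]1, +oo[).
Proof.
move=> C0 v0 v2 vK; pose C' := 1 + C / v 2.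
have v20 : 0 < v 2 by rewrite v0.
have C'1 : 1 <= C' by rewrite lerDl divr_ge0// ltW.
have C'0 : 0 < C' by exact: lt_le_trans C'1.
have normE t f : 0 < t -> `|v t * K_functional f t| = v t * K_functional f t.
  move=> t0; rewrite ger0_norm// mulr_ge0 ?K_functional_ge0 ?ltW//.
  exact: v0.
apply: (@equal_spaces_bound _ _ _ _ C') => //; try by move=> f; exact: K_norm_ge0.
- move=> f; have := K_norm_ge0 (EFin \o v) `]1, +oo[ f.
  case E : (K_norm c (EFin \o v) `]1, +oo[ f) => [y| |] //; last first.
    by move=> _; rewrite gt0_muley ?lte_fin// leey.
  rewrite lee_fin => y0.
  have /Linf_norm_leP : (K_norm c (EFin \o v) `]1%R, +oo[ f <= y%:E)%E by rewrite E.
  rewrite lee_fin => /(_ y0) vy.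
  have [t0] := ae_itv_ex (ltr1n R 2 : 1 < 2) vy.
  rewrite in_itv/= => /andP[t01 t02]; rewrite in_itv/= t01 => /(_ isT).
  have t00 : 0 < t0 by exact: lt_trans t01.
  rewrite /= lee_fin normE// => vKy.
  have K1y : K_functional f 1 <= y / v 2.
    rewrite ler_pdivlMr// mulrC (le_trans _ vKy)//.
    apply: (le_trans (ler_wpM2r _ (v2 t0 t01 t02))).
      exact: K_functional_ge0.
    by rewrite ler_wpM2l ?K_functional_homo ?ltW// v0.
  apply/Linf_norm_leP; first by rewrite -EFinM lee_fin mulr_ge0// ltW.
  apply: lebesgue_aeS vy => t vKt; rewrite in_itv/= andbT => t_gt0.
  have [t1|t1] := leP t 1; last first.
    rewrite (le_trans (vKt _)) ?in_itv/= ?t1// -EFinM lee_fin.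
    by rewrite ler_peMl.
  rewrite /= -EFinM lee_fin normE// (le_trans (vK f t t_gt0 t1))//.
  rewrite (le_trans (ler_wpM2l C0 K1y))// mulrCA mulrC ler_wpM2r//.
  by rewrite lerDr.
- move=> f; apply: (@le_trans _ _ (K_norm c (EFin \o v) `]0, +oo[ f)); last first.
    rewrite -[leLHS]mul1e lee_wpmul2r ?K_norm_ge0//.
  apply/Linf_norm_leP; first exact: K_norm_ge0.
  have /Linf_norm_leP : (K_norm c (EFin \o v) `]0%R, +oo[ f <=
    K_norm c (EFin \o v) `]0%R, +oo[ f)%E by [].
  move=> /(_ (K_norm_ge0 _ _ _)); apply: lebesgue_aeS => t.
  rewrite !in_itv/= !andbT => vK_ t1; apply: vK_; exact: lt_trans t1.
Qed.

End K_spaces.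

Lemma sum_norm_emb0 (R : realType) (c : compatible_couple R) (x : space0 c) :
  `|SumSpace (in_sum_emb0 x) : sum_space c| <= `|x|.
Proof.
rewrite -[leRHS]addr0 -(normr0 (space1 c)); apply: sum_norm_le => /=.
by rewrite raddf0 addr0.
Qed.

(** In the sum of X0 and X0 + X1 the first component of a decomposition can be
    moved to the second one, so that K is linear in t on ]0, 1]. *)
Lemma K_functional_sum_couple (R : realType) (X : compatible_couple R)
    (f : sum_space (sum_couple X)) (t : R) : 0 < t -> t <= 1 ->
  K_functional f t <= t * K_functional f 1.
Proof.
move=> t0 t1; rewrite -ler_pdivrMl//.
apply: le_K_functional => // x0 x1 fE.
rewrite ler_pdivrMl// mul1r.
pose y0 := SumSpace (@in_sum_emb0 R X x0).
have ny0 : `|y0| <= `|x0| by exact: (@sum_norm_emb0 R X x0).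
apply: (@le_trans _ _ (`|0 : space0 X| + t * `|y0 + x1|)).
  apply: K_functional_le; first exact: ltW.
  by rewrite fE raddf0 add0r.
rewrite normr0 add0r ler_wpM2l ?(ltW t0)//.
by rewrite (le_trans (ler_normD _ _))// lerD2r.
Qed.

(** * Weights on the half-line *)

Section half_line_functions.
Context {R : realType}.
Implicit Types b beta : R -> R.

Lemma strictly_decreasing_le b s t : strictly_decreasing b ->
  0 < s -> s <= t -> b t <= b s.
Proof.
move=> bd s0; rewrite le_eqVlt => /predU1P[->//|st].
have t0 := lt_trans s0 st.
by apply/ltW/bd => //; rewrite in_itv/= andbT.
Qed.

Lemma strictly_decreasing_bounded b : strictly_decreasing b ->
    (value_at_0 b < +oo)%E ->
  exists C : R, forall t, 0 < t -> b t <= C.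
Proof.
move=> bd; have nib : {in `]0, +oo[ &, nonincreasing_fun (EFin \o b)}.
  move=> s t; rewrite !in_itv/= !andbT => s0 t0 st; rewrite lee_fin.
  exact: strictly_decreasing_le.
have := @nonincreasing_at_right_cvge R (EFin \o b) 0 (BInfty _ false) _ nib.
rewrite bnd_simp => /(_ isT) bcvg.
rewrite /value_at_0 (cvg_lim _ bcvg)// => bfin.
pose S := ereal_sup [set (EFin \o b) x | x in `]0, +oo[].
have le_S t : 0 < t -> ((b t)%:E <= S)%E.
  by move=> t0; apply: ereal_sup_ubound; exists t => //=; rewrite in_itv/= t0.
have Sfin : S \is a fin_num.
  by rewrite fin_numE -ltey bfin andbT gt_eqF// (lt_le_trans _ (le_S 1 ltr01))// ltNyr.
by exists (fine S) => t t0; rewrite -lee_fin fineK// le_S.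
Qed.

(** With exponent 1, t b(t) is equivalent to a nondecreasing function, hence
    bounded on ]0, 1] by a multiple of its value at 1. *)
Lemma slowly_varying_bound b : slowly_varying b ->
  exists2 C : R, 0 < C & forall t, 0 < t -> t <= 1 -> t * b t <= C.
Proof.
move=> [b0 _ /(_ 1 ltr01)[[g [g0 gh [[C C0 bg] [C' C'0 gb]]]] _]].
exists (C * (C' * b 1)); first by rewrite !mulr_gt0// b0.
move=> t t0 t1; rewrite -[X in X * _](powRr1 (ltW t0)) (le_trans (bg t t0))//.
rewrite ler_pM2l// (@le_trans _ _ (g 1))//.
  by apply: gh => //; rewrite in_itv/= ?t0 ?ltr01.
by have := gb 1 ltr01; rewrite powR1 mul1r.
Qed.

Lemma glued_le b beta c s t : strictly_decreasing b -> strictly_decreasing beta ->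
    0 < c -> locally_absolutely_continuous (glued b beta c) ->
    0 < s -> s <= t ->
  glued b beta c t <= glued b beta c s.
Proof.
move=> bd betad c0 BAC s0 st; rewrite /glued.
have [t1|t1] := leP 1 t; last first.
  by rewrite (leNgt 1 s) (le_lt_trans st t1)/= ler_pM2l// strictly_decreasing_le.
have [s1|s1] := leP 1 s; first exact: strictly_decreasing_le.
apply: (@le_trans _ _ (b 1)); first exact: strictly_decreasing_le.
apply/ler_addgt0Pr => e e0.
(* continuity at the gluing point puts a value of B on [s, 1[ within e of b 1 *)
have [d d0 Bd] := BAC s 1 s0 s1 e e0.
pose r := Num.max s (1 - d / 2).
have sr : s <= r by rewrite le_max lexx.
have r1 : r < 1 by rewrite gt_max s1/= ltrBlDr ltrDl divr_gt0.
have dr : 1 - r < d.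
  have : 1 - d / 2 <= r by rewrite le_max lexx orbT.
  by lra.
have := Bd 1%N (fun=> r) (fun=> 1) (fun=> conj sr (conj (ltW r1) (lexx 1)))
  (fun i j _ _ _ => etrans (ord1 i) (esym (ord1 j))).
rewrite !big_ord1 => /(_ dr); rewrite /glued lexx (leNgt 1 r) r1/=.
rewrite ltr_norml => /andP[_ Bre].
have := strictly_decreasing_le betad s0 sr; rewrite -(ler_pM2l c0).
by lra.
Qed.

End half_line_functions.

(** * The J-spaces *)

Section J_functional_theory.
Context {R : realType} (c : compatible_couple R).
Implicit Types (f g : cap_space c) (t : R).

Lemma J_functional_ge0 f t : 0 <= J_functional f t.
Proof. by rewrite le_max normr_ge0. Qed.

Lemma J_functional0 t : J_functional (0 : cap_space c) t = 0.
Proof. by rewrite /J_functional /= !normr0 mulr0 maxxx. Qed.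

Lemma J_functionalD f g t : 0 <= t ->
  J_functional (f + g) t <= J_functional f t + J_functional g t.
Proof.
move=> t0; rewrite ge_max; apply/andP; split.
  by rewrite (le_trans (ler_normD _ _))// lerD// le_max lexx.
rewrite (le_trans (ler_wpM2l t0 (ler_normD _ _)))// mulrDr lerD//.
  by rewrite le_max lexx orbT.
by rewrite le_max lexx orbT.
Qed.

Lemma J_functionalZ a f t : J_functional (a *: f) t = `|a| * J_functional f t.
Proof. by rewrite /J_functional /= !normrZ mulrCA maxr_pMr. Qed.

Lemma J_norm_ge0 (v : R -> \bar R) i (f : sum_space c) : (0 <= J_norm c v i f)%E.
Proof. by apply: le_ereal_inf_tmp => _ [u _ <-]; exact: Linf_norm_ge0. Qed.

End J_functional_theory.

(** For the couple of a space and a sum, the intersection is the first space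
    itself; the maps below make this identification explicit. *)
Section sum_couple_maps.
Context {R : realType} (X : compatible_couple R).
Local Notation D := (sum_couple X).

Definition cap_fst (f : cap_space D) : space0 X := (cap_val f).1.

Lemma cap_fst_linear : linear cap_fst. Proof. by []. Qed.
HB.instance Definition _ :=
  GRing.isLinear.Build R (cap_space D) (space0 X) _ cap_fst cap_fst_linear.

Lemma cap_fst_norm f : `|cap_fst f| <= `|f|.
Proof. by rewrite le_max lexx. Qed.

Definition to_sum (x : space0 X) : sum_space D :=
  SumSpace (@in_sum_emb0 R D x).

Lemma to_sum_linear : linear to_sum.
Proof.
move=> a x y; apply: val_inj => /=.
by rewrite linearP.
Qed.
HB.instance Definition _ :=
  GRing.isLinear.Build R (space0 X) (sum_space D) _ to_sum to_sum_linear.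

Lemma to_sum_norm x : `|to_sum x| <= 1 * `|x|.
Proof. by rewrite mul1r; exact: sum_norm_emb0. Qed.

Fact in_cap_emb0 (x : space0 X) :
  @in_cap R D (x, SumSpace (in_sum_emb0 x) : sum_space X).
Proof. exact/asboolP. Qed.

Definition to_cap (x : space0 X) : cap_space D := CapSpace (in_cap_emb0 x).

Lemma J_to_cap x t : 1 <= t -> J_functional (to_cap x) t <= t * `|x|.
Proof.
move=> t1; rewrite ge_max ler_peMl//= ler_wpM2l ?(le_trans ler01)//.
exact: sum_norm_emb0.
Qed.

End sum_couple_maps.

Section lebesgue_restriction.
Context {R : realType}.
Local Notation leb := (@lebesgue_measure R).

Lemma strongly_measurable_lebesgue_on (V : normedModType R) (i : interval R)
    (u : R -> V) :
  strongly_measurable (lebesgue_on i) u <->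
  strongly_measurable leb (fun t => (\1_[set` i] t : R) *: u t).
Proof.
exact: (@strongly_measurable_restriction _ _ _ leb (lebesgue_on i) [set` i]).
Qed.

Lemma bochner_integral_lebesgue_on (V : normedModType R) (i : interval R)
    (u : R -> V) x :
  is_bochner_integral (lebesgue_on i) u x <->
  is_bochner_integral leb (fun t => (\1_[set` i] t : R) *: u t) x.
Proof.
exact: (@bochner_integral_restriction _ _ _ leb (lebesgue_on i) [set` i]).
Qed.

Lemma indic_itv_mem (i : interval R) t : t \in i -> \1_[set` i] t = 1 :> R.
Proof. by move=> ti; rewrite indicE mem_set. Qed.

Lemma indic_itv_nmem (i : interval R) t : t \notin i -> \1_[set` i] t = 0 :> R.
Proof. by move=> /negP ti; rewrite indicE memNset. Qed.

End lebesgue_restriction.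

Lemma measurable_indic_itv_inv (R : realType) (i : interval R) :
  [set` i] `<=` `]0, +oo[ ->
  measurable_fun setT (fun t : R => (\1_[set` i] t : R) * t^-1).
Proof.
move=> i0; apply: (@eq_measurable_fun _ _ _ _ setT
  (fun t : R => (\1_[set` i] t : R) * t `^ (-1))).
  move=> t _; rewrite indicE; have [/set_mem/i0|_] := boolP (t \in _).
    by rewrite /= in_itv/= andbT => t0; rewrite powR_inv1// ltW.
  by rewrite !mul0r.
apply: measurable_funM; first by apply: measurable_indic.
exact: measurable_powR.
Qed.

Section J_spaces.
Context {R : realType} (X : compatible_couple R).
Local Notation D := (sum_couple X).
Local Notation leb := (@lebesgue_measure R).

(** Extension by zero to ]0, 1], where the convention 0 * oo = 0 lets A be
    infinite. *)
Lemma J_norm_extension (A : R -> \bar R) f :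
  (J_norm D A `]0%R, +oo[ f <= J_norm D A `]1%R, +oo[ f)%E.
Proof.
apply: le_ereal_inf_tmp => _ [u [su iu] <-].
pose u' t : cap_space D := (\1_`]1, +oo[ t : R) *: u t.
have ind01 (t : R) : (\1_`]0, +oo[ t : R) * \1_`]1, +oo[ t = \1_`]1, +oo[ t.
  have [t1|t1] := boolP (t \in `]1, +oo[); last first.
    by rewrite (indic_itv_nmem t1) mulr0.
  rewrite !indic_itv_mem ?mulr1//; move: t1; rewrite !in_itv/= !andbT.
  exact: lt_trans.
apply: (@le_trans _ _ (Linf_norm `]0, +oo[
    (fun t => A t * (J_functional (u' t) t)%:E)%E)); last first.
  apply/Linf_norm_leP; first exact: Linf_norm_ge0.
  have := lexx (Linf_norm `]1, +oo[ (fun t => A t * (J_functional (u t) t)%:E)%E).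
  move/Linf_norm_leP => /(_ (Linf_norm_ge0 _ _)); apply: lebesgue_aeS => t Au _.
  rewrite /u'; have [t1|t1] := boolP (t \in `]1, +oo[).
    by rewrite indic_itv_mem// scale1r Au.
  by rewrite indic_itv_nmem// scale0r J_functional0 mule0 abse0 Linf_norm_ge0.
apply: ereal_inf_lbound; exists u' => //; split.
  apply/strongly_measurable_lebesgue_on.
  move/strongly_measurable_lebesgue_on in su.
  apply: strongly_measurable_ae su; apply: aeW => t.
  by rewrite /u' scalerA ind01.
apply/bochner_integral_lebesgue_on.
move/bochner_integral_lebesgue_on in iu.
apply: bochner_integral_ae iu; apply: aeW => t.
rewrite /u' -[cap_in_sum (_ *: _)]/(to_sum (cap_fst (_ *: _))) !linearZ/=.
by rewrite !scalerA; congr (_ *: _); rewrite -mulrA [X in _ = _ * X]mulrC ind01.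
Qed.

Variables (B : R -> R).
Hypothesis B0 : forall t : R, 0 < t -> 0 < B t.
Hypothesis Bni : forall s t : R, 0 < s -> s <= t -> B t <= B s.

(** The quotient 1 / (t A) is the derivative of 1 / B. Where B has no derivative,
    or a zero one, A is +oo and the bound forces y = 0; elsewhere the lower
    derivative of 1 / B is its derivative. *)
Lemma weight_A_bound (M y t : R) : 0 <= y -> 0 < t ->
    (`|weight_A B t * y%:E| <= M%:E)%E ->
  ((t^-1 * y)%:E <= M%:E * lower_derivative (reciprocal B) t)%E.
Proof.
move=> y0 t0 AM.
have M0 : 0 <= M by rewrite -lee_fin (le_trans _ AM)// abse_ge0.
have [d0|d0] := eqVneq (derive1 B t) 0.
  have Ay : weight_A B t = +oo%E.
    rewrite /weight_A d0 oppr0 mulr0 inver eqxx gt0_muley// lte_fin.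
    by rewrite exprn_gt0// B0.
  have -> : y = 0.
    apply/eqP; rewrite eq_le y0 andbT leNgt; apply/negP => y_gt0.
    by move: AM; rewrite Ay gt0_mulye ?lte_fin.
  rewrite mulr0 mule_ge0 ?lee_fin//; apply: lower_derivative_ge0.
  exact: reciprocal_homo.
have [d_lt0 ->] := lower_derivative_reciprocal B0 Bni t0 d0.
move: AM; rewrite /weight_A inver mulf_eq0 (gt_eqF t0) oppr_eq0 (negbTE d0)/=.
set d := derive1 B t in d0 d_lt0 *; have Bt := B0 t0.
have p0 : 0 <= B t ^+ 2 * (t * - d)^-1 * y.
  by rewrite !mulr_ge0// ?exprn_ge0 ?invr_ge0 ?mulr_ge0 ?oppr_ge0// ltW.
rewrite !lee_fin ger0_norm// => AM.
have -> : t^-1 * y = (B t ^+ 2 * (t * - d)^-1 * y) * (- d / B t ^+ 2).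
  by field; rewrite d0 !gt_eqF.
by rewrite ler_wpM2r// divr_ge0 ?exprn_ge0 ?oppr_ge0// ltW.
Qed.

(** The part of the representation over ]0, 1[ converges already in the first
    space, since its norm is dominated there by M times the lower derivative of
    1 / B. *)
Lemma J_representation_bound (u : R -> cap_space D) (M : R) : 0 <= M ->
    strongly_measurable (lebesgue_on `]0, +oo[) u ->
    {ae leb, forall t, t \in `]0, +oo[ ->
      (`|weight_A B t * (J_functional (u t) t)%:E| <= M%:E)%E} ->
  exists2 x : space0 X, `|x| <= M * (B 2)^-1 &
    is_bochner_integral leb
      (fun t => ((\1_`]0, 1[ t : R) * t^-1) *: cap_fst (u t)) x.
Proof.
move=> M0 /strongly_measurable_lebesgue_on su Au.
pose w t := ((\1_`]0, 1[ t : R) * t^-1) *: cap_fst (u t).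
have F0 x : 0 <= reciprocal B x by exact: reciprocal_ge0.
have Fh := reciprocal_homo B0 Bni.
have m01 : measurable_fun [set: measurableTypeR R]
    (fun t : R => (\1_`]0, 1[ t : R) * t^-1).
  apply: (@measurable_indic_itv_inv _ `]0, 1[) => t /=.
  by rewrite !in_itv/= => /andP[->].
have sw : strongly_measurable leb w.
  have cfst : continuous (@cap_fst R X).
    apply: bounded_linear_continuous; apply/linear_boundedP.
    near=> r => v; apply: (le_trans (cap_fst_norm v)); apply: ler_peMl => //.
  have := strongly_measurable_scale m01 (strongly_measurable_comp cfst su).
  apply: strongly_measurable_ae; apply: aeW => t /=.
  rewrite /w [cap_fst (_ *: _)]linearZ scalerA; have [t0|t0] := boolP (t \in `]0, +oo[).
    by rewrite (indic_itv_mem t0) mulr1.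
  rewrite (@indic_itv_nmem _ `]0, 1[) ?mul0r//; apply: contra t0.
  by rewrite !in_itv/= => /andP[->].
have wG : (\int[leb]_t `|w t|%:E <= (M * (B 2)^-1)%:E)%E.
  apply: (@le_trans _ _ (\int[leb]_t (M%:E *
      (lower_derivative (reciprocal B) \_ `]0%R, 1%R[) t))%E).
    apply: ge0_ae_le_lower_integral => [t|t||].
    - by rewrite lee_fin.
    - rewrite mule_ge0 ?lee_fin// patchE; case: ifPn => // _.
      exact: lower_derivative_ge0.
    - apply: emeasurable_funM; first exact: measurable_cst.
      apply/(measurable_restrictT _ _).1 => //.
      by apply: measurable_funS (measurable_lower_derivative Fh).
    apply: lebesgue_aeS Au => t Au; rewrite patchE /w.
    have [t01|t01] := boolP (t \in `]0, 1[); last first.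
      rewrite indic_itv_nmem// mul0r scale0r normr0 mule_ge0 ?lee_fin//.
      by case: ifP => // _; exact: lower_derivative_ge0.
    rewrite indic_itv_mem// mul1r mem_set//.
    move: t01; rewrite in_itv/= => /andP[t0 t1].
    rewrite normrZ gtr0_norm ?invr_gt0//; apply: weight_A_bound => //.
    apply: le_trans (Au _); last by rewrite in_itv/= t0.
    rewrite !abseM lee_wpmul2l// !gee0_abs ?lee_fin ?J_functional_ge0//.
    by rewrite le_max lexx.
  rewrite ge0_integralZl_EFin//; first last.
  - apply/(measurable_restrictT _ _).1 => //.
    by apply: measurable_funS (measurable_lower_derivative Fh).
  - move=> t _; rewrite patchE; case: ifP => // _; exact: lower_derivative_ge0.
  rewrite -integral_mkcond EFinM lee_wpmul2l ?lee_fin//.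
  apply: (le_trans (integral_lower_derivative_le Fh F0)).
  by rewrite /reciprocal ltr0n.
have [x iw] := bochner_integral_exists sw (le_lt_trans wG (ltry _)).
exists x => //; rewrite -lee_fin.
exact: le_trans (bochner_integral_norm iw) wG.
Unshelve. all: by end_near. Qed.

End J_spaces.

Section J_spaces_restriction.
Context {R : realType} (X : compatible_couple R).
Local Notation D := (sum_couple X).
Local Notation leb := (@lebesgue_measure R).
Variables (B : R -> R).
Hypothesis B0 : forall t : R, 0 < t -> 0 < B t.
Hypothesis Bni : forall s t : R, 0 < s -> s <= t -> B t <= B s.

(** Here x is the integral of u(t) / t over ]0, 1[, put back as a multiple of x on
    ]1, 2[; the factor t cancels the 1 / t of the integrating measure, and the
    interval has length 1. *)
Definition replace_on_0_1 (u : R -> cap_space D) (x : space0 X) (t : R) :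
    cap_space D :=
  (\1_`]1, +oo[ t : R) *: u t + ((\1_`]1, 2[ t : R) * t) *: to_cap x.

Lemma J_representation_replace (u : R -> cap_space D) (x : space0 X) f :
    J_representation `]0, +oo[ f u ->
    is_bochner_integral leb
      (fun t => ((\1_`]0, 1[ t : R) * t^-1) *: cap_fst (u t)) x ->
  J_representation `]1, +oo[ f (replace_on_0_1 u x).
Proof.
move=> [su iu] ix.
have ind (t : R) : 1 < t -> [/\ (\1_`]0, +oo[ t : R) = 1, (\1_`]1, +oo[ t : R) = 1 &
    (\1_`]0, 1[ t : R) = 0].
  move=> t1; split.
  - by rewrite indic_itv_mem// in_itv/= (lt_trans ltr01 t1).
  - by rewrite indic_itv_mem// in_itv/= t1.
  - by rewrite indic_itv_nmem// in_itv/= [t < 1]ltNge (ltW t1) andbF.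
have ind0 (t : R) : t <= 1 -> (\1_`]1, +oo[ t : R) = 0 /\ (\1_`]1, 2[ t : R) = 0.
  by move=> t1; rewrite !indic_itv_nmem// in_itv/= ltNge t1.
split.
  apply/strongly_measurable_lebesgue_on.
  move/strongly_measurable_lebesgue_on in su.
  have m1 : measurable_fun [set: measurableTypeR R] (\1_`]1, +oo[ : R -> R).
    exact: measurable_indic.
  have m2 : measurable_fun [set: measurableTypeR R]
      (fun t : R => (\1_`]1, 2[ t : R) * t).
    by apply: measurable_funM => //; exact: measurable_indic.
  have s2 := strongly_measurable_scale m2
    (simple_strongly_measurable leb (simple_fun_cst _ (to_cap x))).
  have := strongly_measurable_lin 1 (strongly_measurable_scale m1 su) s2.
  apply: strongly_measurable_ae; apply: aeW => t /=; rewrite /replace_on_0_1.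
  have [t1|t1] := leP t 1.
    by have [-> ->] := ind0 t t1; rewrite mul0r !scale0r scaler0 addr0.
  by have [-> -> _] := ind t t1; rewrite !scale1r.
apply/bochner_integral_lebesgue_on.
move/bochner_integral_lebesgue_on in iu.
have ix' := @bochner_integral_linear _ _ _ leb _ _ (@to_sum R X) 1 _ _
  ler01 (@to_sum_norm R X) ix.
have l12 : lebesgue_measure `]1%R, 2%R[ = 1%:E :> \bar R.
  by rewrite lebesgue_measure_itv/= lte_fin ltr1n -EFinB -[2%R]/(1 + 1) addrK.
have i12 : is_bochner_integral leb (fun t => (\1_`]1, 2[ t : R) *: to_sum x)
    (fine (leb `]1%R, 2%R[) *: to_sum x).
  apply: bochner_integral_indic; first exact: measurable_itv.
  by rewrite [ltLHS]l12 ltry.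
rewrite l12 /= scale1r in i12.
have := bochner_integral_lin 1 (bochner_integral_lin (-1) iu ix') i12.
rewrite scaleN1r scale1r subrK; apply: bochner_integral_ae.
(* the two functions differ at 1 only, an end point of both intervals *)
exists [set 1]; split; [exact: measurable_set1|exact: lebesgue_measure_set1|].
move=> t /= ne; apply: contrapT => t_neq1; apply: ne.
rewrite -[cap_in_sum (u t)]/(to_sum (cap_fst (u t))).
rewrite -[cap_in_sum (replace_on_0_1 u x t)]/(to_sum (cap_fst _)).
rewrite /replace_on_0_1 scaleN1r scale1r.
have [t1|t1] := leP t 1.
  have [i1 i2] := ind0 t t1; rewrite i1 i2 !scale0r addr0.
  have [t0|t0] := leP t 0.
    rewrite !indic_itv_nmem ?in_itv/= ?[0 < t]ltNge ?t0//.
    by rewrite mul0r !scale0r raddf0 subrr.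
  have t1' : t < 1 by rewrite lt_neqAle t1 andbT; exact/eqP.
  rewrite !indic_itv_mem ?in_itv/= ?t0 ?t1'// mul1r scale1r.
  by rewrite linearZ subrr.
have [-> i1 ->] := ind t t1; rewrite i1 mul0r scale0r raddf0 subr0 !scale1r.
rewrite -[cap_fst (_ + _)]/(cap_fst (u t) + _ *: x) [_ + _ *: x]addrC.
rewrite to_sum_linear addrC scalerDr scalerA; congr (_ *: _ + _).
by rewrite mulrCA mulVf ?mulr1// gt_eqF// (lt_trans ltr01).
Qed.

(** The X0-norm of the mass moved to ]1, 2[ is at most M / B 2, and it costs a
    factor of at most 4 in the J-functional there. *)
Lemma J_norm_restriction (K : R) : let A := weight_A B in 0 <= K ->
    {ae leb, forall t, t \in `]1, expR 1[ -> (`|A t| <= K%:E)%E} ->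
  forall f, (J_norm D A `]1%R, +oo[ f <=
    (1 + K * (4 * (B 2)^-1))%:E * J_norm D A `]0%R, +oo[ f)%E.
Proof.
move=> A K0 AK f; set C := 1 + _.
have B2 : 0 < (B 2)^-1 by rewrite invr_gt0 B0.
have C0 : 0 < C.
  by rewrite (@lt_le_trans _ _ 1)// lerDl !mulr_ge0// ltW.
rewrite -lee_pdivrMl//; apply: le_ereal_inf_tmp => _ [u ru <-].
rewrite lee_pdivrMl//; have := Linf_norm_ge0 `]0, +oo[
  (fun t => A t * (J_functional (u t) t)%:E)%E.
case E : Linf_norm => [M| |] //; last first.
  by move=> _; rewrite gt0_muley ?lte_fin// leey.
rewrite lee_fin => M0.
have /Linf_norm_leP : (Linf_norm `]0%R, +oo[
    (fun t => A t * (J_functional (u t) t)%:E) <= M%:E)%E by rewrite E.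
rewrite lee_fin => /(_ M0) Au.
have [x xM ix] := J_representation_bound B0 Bni M0 ru.1 Au.
apply: (@le_trans _ _ (Linf_norm `]1, +oo[
    (fun t => A t * (J_functional (replace_on_0_1 u x t) t)%:E)%E)).
  apply: ereal_inf_lbound; exists (replace_on_0_1 u x) => //.
  exact: J_representation_replace.
apply/Linf_norm_leP; first by rewrite -EFinM lee_fin mulr_ge0// ltW.
apply: lebesgue_aeS (lebesgue_aeI Au AK) => t [{}Au {}AK].
rewrite in_itv/= andbT => t1; have t0 := lt_trans ltr01 t1.
have /Au {}Au : t \in `]0, +oo[ by rewrite in_itv/= t0.
have absJ (w : cap_space D) : (`|A t * (J_functional w t)%:E| =
    `|A t| * (J_functional w t)%:E)%E.
  by rewrite abseM [X in (_ * X)%E]gee0_abs// lee_fin J_functional_ge0.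
rewrite absJ in Au; rewrite absJ.
rewrite /replace_on_0_1 indic_itv_mem ?in_itv/= ?t1// scale1r.
have [t2|t2] := boolP (t \in `]1, 2[); last first.
  rewrite indic_itv_nmem// mul0r scale0r addr0 (le_trans Au)// -EFinM lee_fin.
  by rewrite ler_peMl// lerDl !mulr_ge0// ltW.
rewrite indic_itv_mem// mul1r.
move: t2; rewrite in_itv/= => /andP[_ t2].
have {}AK : (`|A t| <= K%:E)%E.
  apply: AK; rewrite in_itv/= t1 (lt_le_trans t2)//.
  exact: (expR_ge1Dx (1 : R)).
(* t <= 2 twice: in the factor t and in the J-functional at t *)
have Jx : J_functional (t *: to_cap x) t <= 4 * `|x|.
  rewrite J_functionalZ gtr0_norm//.
  rewrite (le_trans (ler_wpM2l (ltW t0) (J_to_cap x (ltW t1))))// mulrA.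
  by rewrite ler_wpM2r//; nra.
apply: (@le_trans _ _ (`|A t| * ((J_functional (u t) t)%:E + (4 * `|x|)%:E))%E).
  rewrite lee_wpmul2l// -EFinD lee_fin.
  by rewrite (le_trans (J_functionalD _ _ (ltW t0)))// lerD2l.
rewrite ge0_muleDr ?lee_fin ?J_functional_ge0// ?mulr_ge0//.
have -> : (C%:E * M%:E = M%:E + (K * (4 * (B 2)^-1) * M)%:E)%E.
  by rewrite -EFinM -EFinD /C [(1 + _) * M]mulrDl mul1r.
rewrite leeD//.
apply: (@le_trans _ _ (K%:E * (4 * `|x|)%:E)%E).
  by rewrite lee_wpmul2r// lee_fin mulr_ge0.
rewrite -EFinM lee_fin -[leRHS]mulrA ler_wpM2l// -mulrA ler_wpM2l//.
by rewrite mulrC.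
Qed.

End J_spaces_restriction.

Theorem mainTheorem10 (R : realType) (X : compatible_couple R)
    (b beta : R -> R) (c : R) :
  let B := glued b beta c in
  let A := weight_A B in
  slowly_varying b -> locally_absolutely_continuous b ->
  strictly_decreasing b ->
  (value_at_0 b < +oo)%E -> value_at_oo b = 0%E ->
  slowly_varying beta -> locally_absolutely_continuous beta ->
  strictly_decreasing beta ->
  value_at_0 beta = +oo%E -> value_at_oo beta = 0%E ->
  0 < c ->
  slowly_varying B -> locally_absolutely_continuous B ->
  [/\ equal_spaces
        (K_norm X (EFin \o b) `]0, +oo[) (K_norm X (EFin \o b) `]1, +oo[),
      equal_spaces
        (K_norm (sum_couple X) (EFin \o B) `]0, +oo[)
        (K_norm (sum_couple X) (EFin \o B) `]1, +oo[) &
      (Linf_norm `]1%R, expR 1[%R A < +oo)%E ->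
      equal_spaces
        (J_norm (sum_couple X) A `]0, +oo[) (J_norm (sum_couple X) A `]1, +oo[)].
Proof.
move=> B A [b0 _ _] _ bd b_bnd _ _ _ betad _ _ c0 Bsv BAC.
have [B0 _ _] := Bsv.
have Bni s t : 0 < s -> s <= t -> B t <= B s by exact: glued_le.
split.
- have [C bC] := strictly_decreasing_bounded bd b_bnd.
  have C0 : 0 < C := lt_le_trans (b0 1 ltr01) (bC 1 ltr01).
  apply: (@K_equal_spaces _ _ _ C) => //; first exact: ltW.
    move=> t t1 t2; apply: (strictly_decreasing_le bd _ (ltW t2)).
    exact: lt_trans t1.
  move=> f t t0 t1; apply: ler_pM; rewrite ?(ltW (b0 t t0))// ?bC//.
    by rewrite K_functional_ge0// ltW.
  by rewrite K_functional_homo// ltW.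
- have [C C0 BC] := slowly_varying_bound Bsv.
  apply: (@K_equal_spaces _ _ _ C) => //; first exact: ltW.
    by move=> t t1 t2; apply: (Bni _ _ _ (ltW t2)); exact: lt_trans t1.
  move=> f t t0 t1.
  rewrite (le_trans (ler_wpM2l (ltW (B0 t t0)) (K_functional_sum_couple f t0 t1)))//.
  by rewrite mulrA [B t * t]mulrC ler_wpM2r ?BC// K_functional_ge0.
move=> Afin; have := Linf_norm_ge0 `]1, expR 1[ A.
case E : (Linf_norm `]1, expR 1[ A) Afin => [K| |] // _ K0.
have /Linf_norm_leP : (Linf_norm `]1%R, expR 1%R[ A <= K%:E)%E by rewrite E.
move=> /(_ K0) AK; rewrite lee_fin in K0.
pose C := 1 + K * (4 * (B 2)^-1).
have C1 : 1 <= C by rewrite lerDl !mulr_ge0// invr_ge0 ltW// B0.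
apply: (@equal_spaces_bound _ _ _ _ C); try by move=> f; exact: J_norm_ge0.
- exact: lt_le_trans C1.
- move=> f; apply: (le_trans (J_norm_extension A f)).
  by rewrite -[leLHS]mul1e lee_wpmul2r ?J_norm_ge0// lee_fin.
- exact: (J_norm_restriction B0 Bni K0 AK).
Qed.
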